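(* Let $\Lambda$ be an artin algebra, $n$ a positive integer and $\mathcal{M}$ an $n$-cluster tilting subcategory of $\mathrm{mod}\text{-}\Lambda$. There exists an equivalence of additive categories $$\mathcal{S}(\mathcal{M})/\mathcal{V}\simeq\mathrm{mod}\text{-}\underline{\mathcal{M}},$$ where $\mathcal{V}$ is the full subcategory of $\mathcal{S}(\mathcal{M})$ generated by all finite direct sums of objects of the form $(M\xrightarrow{1}M)$ and $(0\to M)$, where $M$ runs over objects of $\mathcal{M}$.
   Context: $\mathrm{mod}\text{-}\Lambda$ is the category of finitely generated $\Lambda$-modules; all subcategories are full. A full additive subcategory $\mathcal{M}$ of $\mathrm{mod}\text{-}\Lambda$ is $n$-cluster tilting if it is functorially finite (every module has a right and a left $\mathcal{M}$-approximation), generating-cogenerating (every module is a quotient of an object of $\mathcal{M}$ and embeds in an object of $\mathcal{M}$), and $$\mathcal{M}=\{A: \mathrm{Ext}^i_\Lambda(\mathcal{M},A)=0,\ 0<i<n\}=\{A: \mathrm{Ext}^i_\Lambda(A,\mathcal{M})=0,\ 0<i<n\}.$$ $\mathcal{S}(\mathcal{M})$ is the category whose objects are monomorphisms $f:M_1\to M_2$ of $\Lambda$-modules with $M_1,M_2\in\mathcal{M}$, and whose morphisms are commutative squares. $\mathrm{mod}\text{-}\underline{\mathcal{M}}$ is the category of finitely presented additive contravariant functors $\mathcal{M}\to\mathrm{Ab}$ that vanish on projective $\Lambda$-modules; equivalently, the finitely presented additive contravariant functors on $\underline{\mathcal{M}}$, the quotient of $\mathcal{M}$ by morphisms factoring through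 projective $\Lambda$-modules. For a class $\mathcal{K}$ of objects of an additive category $\mathcal{X}$, $\mathcal{X}/\mathcal{K}$ is the quotient of $\mathcal{X}$ by the ideal of morphisms factoring through a finite direct sum of objects of $\mathcal{K}$. *)

(* Defs.v *)
From HB Require Import structures.
From Stdlib Require Import Setoid Morphisms.
From mathcomp Require Import all_boot all_algebra.
From mathcomp Require Import boolp.

Set Implicit Arguments.
Unset Strict Implicit.
Unset Printing Implicit Defensive.

Import GRing.Theory.
Local Open Scope ring_scope.

(* Hom-sets are setoids: [heq] is the equality of morphisms.  In this way a
    quotient category has the same morphisms as the original one and a coarser
    [heq].  [comp g f] is "g after f". *)

Record preadd := Preadd {
  obj :> Type;
  hom : obj -> obj -> Type;
  heq : forall x y, hom x y -> hom x y -> Prop;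
  hzero : forall x y, hom x y;
  hopp : forall x y, hom x y -> hom x y;
  hadd : forall x y, hom x y -> hom x y -> hom x y;
  idm : forall x, hom x x;
  comp : forall x y z, hom y z -> hom x y -> hom x z;
  heq_equiv : forall x y, Equivalence (@heq x y);
  hopp_proper : forall x y (f f' : hom x y),
    heq f f' -> heq (hopp f) (hopp f');
  hadd_proper : forall x y (f f' g g' : hom x y),
    heq f f' -> heq g g' -> heq (hadd f g) (hadd f' g');
  comp_proper : forall x y z (g g' : hom y z) (f f' : hom x y),
    heq g g' -> heq f f' -> heq (comp g f) (comp g' f');
  haddA : forall x y (f g h : hom x y),
    heq (hadd f (hadd g h)) (hadd (hadd f g) h);
  haddC : forall x y (f g : hom x y), heq (hadd f g) (hadd g f);
  hadd0f : forall x y (f : hom x y), heq (hadd (hzero x y) f) f;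
  haddNf : forall x y (f : hom x y), heq (hadd (hopp f) f) (hzero x y);
  compA : forall x y z t (h : hom z t) (g : hom y z) (f : hom x y),
    heq (comp h (comp g f)) (comp (comp h g) f);
  comp1f : forall x y (f : hom x y), heq (comp (idm y) f) f;
  compf1 : forall x y (f : hom x y), heq (comp f (idm x)) f;
  compDl : forall x y z (g g' : hom y z) (f : hom x y),
    heq (comp (hadd g g') f) (hadd (comp g f) (comp g' f));
  compDr : forall x y z (g : hom y z) (f f' : hom x y),
    heq (comp g (hadd f f')) (hadd (comp g f) (comp g f')) }.

Arguments hom {p} x y.
Arguments heq {p x y} f g.
Arguments hzero {p} x y.
Arguments hopp {p x y} f.
Arguments hadd {p x y} f g.
Arguments idm {p} x.
Arguments comp {p x y z} g f.

Declare Scope cat_scope.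
Delimit Scope cat_scope with C.
Notation "f =h g" := (heq f g) (at level 70, no associativity) : cat_scope.
Notation "g \oc f" := (comp g f) (at level 40, left associativity) : cat_scope.
Notation "f +h g" := (hadd f g) (at level 50, left associativity) : cat_scope.
Local Open Scope cat_scope.

#[export] Existing Instance heq_equiv.

#[export] Instance hopp_Proper (C : preadd) (x y : C) :
  Proper (heq ==> heq) (@hopp C x y).
Proof. by move=> ? ?; apply: hopp_proper. Qed.

#[export] Instance hadd_Proper (C : preadd) (x y : C) :
  Proper (heq ==> heq ==> heq) (@hadd C x y).
Proof. by move=> ? ? ? ? ? ?; apply: hadd_proper. Qed.

#[export] Instance comp_Proper (C : preadd) (x y z : C) :
  Proper (heq ==> heq ==> heq) (@comp C x y z).
Proof. by move=> ? ? ? ? ? ?; apply: comp_proper. Qed.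

Section PreaddTheory.
Variable C : preadd.
Implicit Types x y z : C.

Lemma hrefl x y (f : hom x y) : f =h f.
Proof. reflexivity. Qed.
Hint Resolve hrefl : core.

Lemma hsym x y (f g : hom x y) : f =h g -> g =h f.
Proof. by move=> ->. Qed.

Lemma htrans x y (f g h : hom x y) : f =h g -> g =h h -> f =h h.
Proof. by move=> ->. Qed.

Lemma haddf0 x y (f : hom x y) : f +h hzero x y =h f.
Proof. by rewrite haddC hadd0f. Qed.

Lemma haddfN x y (f : hom x y) : f +h hopp f =h hzero x y.
Proof. by rewrite haddC haddNf. Qed.

Lemma haddIf x y (f g h : hom x y) : f +h g =h f +h h -> g =h h.
Proof.
move=> e; rewrite -(hadd0f g) -(haddNf f) -haddA e haddA haddNf.
by rewrite hadd0f.
Qed.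

Lemma haddACA x y (a b c d : hom x y) :
  (a +h b) +h (c +h d) =h (a +h c) +h (b +h d).
Proof.
rewrite -!haddA; apply: hadd_proper => //.
by rewrite !haddA (haddC b c).
Qed.

Lemma comp0f x y z (f : hom x y) : hzero y z \oc f =h hzero x z.
Proof.
apply: (@haddIf _ _ (hzero y z \oc f)).
by rewrite -compDl !haddf0.
Qed.

Lemma compf0 x y z (g : hom y z) : g \oc hzero x y =h hzero x z.
Proof.
apply: (@haddIf _ _ (g \oc hzero x y)).
by rewrite -compDr !haddf0.
Qed.

Lemma hopp_uniq x y (f g : hom x y) : f +h g =h hzero x y -> g =h hopp f.
Proof. by move=> e; apply: (@haddIf _ _ f); rewrite e haddfN. Qed.

Lemma compNf x y z (g : hom y z) (f : hom x y) :
  hopp g \oc f =h hopp (g \oc f).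
Proof. by apply: hopp_uniq; rewrite -compDl haddfN comp0f. Qed.

Lemma compfN x y z (g : hom y z) (f : hom x y) :
  g \oc hopp f =h hopp (g \oc f).
Proof. by apply: hopp_uniq; rewrite -compDr haddfN compf0. Qed.

End PreaddTheory.
#[export] Hint Resolve hrefl : core.

Definition is_zero (C : preadd) (z : C) := idm z =h hzero z z.

Definition is_biproduct (C : preadd) (x y z : C) :=
  exists (i1 : hom x z) (i2 : hom y z) (p1 : hom z x) (p2 : hom z y),
    [/\ p1 \oc i1 =h idm x, p2 \oc i2 =h idm y,
        p1 \oc i2 =h hzero y x, p2 \oc i1 =h hzero x y
      & (i1 \oc p1) +h (i2 \oc p2) =h idm z].

Definition iso (C : preadd) (x y : C) :=
  exists (f : hom x y) (g : hom y x), g \oc f =h idm x /\ f \oc g =h idm y.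

Record additive_cat := AdditiveCat {
  acat :> preadd;
  has_zero : exists z : acat, is_zero z;
  has_biproducts : forall x y : acat, exists z : acat, is_biproduct x y z }.

Definition op (C : preadd) : preadd.
Proof.
refine (@Preadd C (fun x y => @hom C y x) (fun x y => @heq C y x)
  (fun x y => hzero y x) (fun x y => hopp) (fun x y => hadd) (fun x => idm x)
  (fun x y z g f => f \oc g) _ _ _ _ _ _ _ _ _ _ _ _ _) => *.
- exact: hopp_proper.
- exact: hadd_proper.
- exact: comp_proper.
- exact: haddA.
- exact: haddC.
- exact: hadd0f.
- exact: haddNf.
- exact/hsym/compA.
- exact: compf1.
- exact: comp1f.
- exact: compDr.
- exact: compDl.
Defined.

Definition full_sub (C : preadd) (P : C -> Prop) : preadd.
Proof.
refine (@Preadd {x : C | P x} (fun x y => hom (sval x) (sval y))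
  (fun x y => heq) (fun x y => hzero _ _) (fun x y => hopp)
  (fun x y => hadd) (fun x => idm _) (fun x y z => comp)
  _ _ _ _ _ _ _ _ _ _ _ _ _) => *.
- exact: hopp_proper.
- exact: hadd_proper.
- exact: comp_proper.
- exact: haddA.
- exact: haddC.
- exact: hadd0f.
- exact: haddNf.
- exact: compA.
- exact: comp1f.
- exact: compf1.
- exact: compDl.
- exact: compDr.
Defined.

Record functor (C D : preadd) := Functor {
  fobj :> C -> D;
  fmap : forall x y, hom x y -> hom (fobj x) (fobj y);
  fmap_proper : forall x y (f g : hom x y), f =h g -> fmap f =h fmap g;
  fmap1 : forall x, fmap (idm x) =h idm (fobj x);
  fmap_comp : forall x y z (g : hom y z) (f : hom x y),
    fmap (g \oc f) =h fmap g \oc fmap f;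
  fmapD : forall x y (f g : hom x y), fmap (f +h g) =h fmap f +h fmap g }.

Arguments fmap {C D} _ {x y} _.

Record nat_trans (C D : preadd) (F G : functor C D) := NatTrans {
  nt :> forall x, hom (F x) (G x);
  nt_nat : forall x y (f : hom x y), fmap G f \oc nt x =h nt y \oc fmap F f }.

Section FunctorCategory.
Variables C D : preadd.
Implicit Types F G H : functor C D.

Definition nt_zero F G : nat_trans F G.
Proof.
by exists (fun x => hzero _ _) => x y f; rewrite compf0 comp0f.
Defined.

Definition nt_opp F G (a : nat_trans F G) : nat_trans F G.
Proof.
by exists (fun x => hopp (a x)) => x y f; rewrite compfN compNf nt_nat.
Defined.

Definition nt_add F G (a b : nat_trans F G) : nat_trans F G.
Proof.
by exists (fun x => a x +h b x) => x y f; rewrite compDr compDl !nt_nat.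
Defined.

Definition nt_id F : nat_trans F F.
Proof. by exists (fun x => idm (F x)) => x y f; rewrite comp1f compf1. Defined.

Definition nt_comp F G H (b : nat_trans G H) (a : nat_trans F G) :
  nat_trans F H.
Proof.
by exists (fun x => b x \oc a x) => x y f; rewrite compA nt_nat -compA nt_nat compA.
Defined.

Definition funcat : preadd.
Proof.
refine (@Preadd (functor C D) (@nat_trans C D)
  (fun F G a b => forall x, a x =h b x)
  nt_zero nt_opp nt_add nt_id nt_comp _ _ _ _ _ _ _ _ _ _ _ _ _).
- move=> F G; split=> [a x|a b e x|a b c e e' x] //; first exact: hsym.
  by rewrite e e'.
- by move=> F G a b e x; apply: hopp_proper.
- by move=> F G a b c d e e' x; apply: hadd_proper.
- by move=> F G H a b c d e e' x; apply: comp_proper.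
- by move=> *; apply: haddA.
- by move=> *; apply: haddC.
- by move=> *; apply: hadd0f.
- by move=> *; apply: haddNf.
- by move=> *; apply: compA.
- by move=> *; apply: comp1f.
- by move=> *; apply: compf1.
- by move=> *; apply: compDl.
- by move=> *; apply: compDr.
Defined.

End FunctorCategory.

Definition functor_id (C : preadd) : functor C C.
Proof. by exists (fun x => x) (fun x y f => f). Defined.

Definition functor_comp (C D E : preadd) (G : functor D E) (F : functor C D) :
  functor C E.
Proof.
exists (fun x => G (F x)) (fun x y f => fmap G (fmap F f)).
- by move=> x y f g e; do 2!apply: fmap_proper.
- by move=> x; rewrite -fmap1; apply: fmap_proper; apply: fmap1.
- by move=> x y z g f; rewrite -fmap_comp; apply: fmap_proper; apply: fmap_comp.
- by move=> x y f g; rewrite -fmapD; apply: fmap_proper; apply: fmapD.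
Defined.

(* Functors are additive by definition, so this is an equivalence of additive
   categories. *)
Definition equivalent (C D : additive_cat) :=
  exists (F : functor C D) (G : functor D C),
    iso (functor_comp G F : funcat C C) (functor_id C) /\
    iso (functor_comp F G : funcat D D) (functor_id D).

Record arrow (C : preadd) := Arrow {
  src : C; tgt : C; arr : hom src tgt }.

Record square (C : preadd) (a b : arrow C) := Square {
  sq_src : hom (src a) (src b);
  sq_tgt : hom (tgt a) (tgt b);
  sq_comm : arr b \oc sq_src =h sq_tgt \oc arr a }.

Section ArrowCategory.
Variable C : preadd.
Implicit Types a b c : arrow C.

Definition sq_zero a b : square a b.
Proof. by exists (hzero _ _) (hzero _ _); rewrite compf0 comp0f. Defined.

Definition sq_opp a b (f : square a b) : square a b.
Proof.
by exists (hopp (sq_src f)) (hopp (sq_tgt f)); rewrite compfN compNf sq_comm.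
Defined.

Definition sq_add a b (f g : square a b) : square a b.
Proof.
by exists (sq_src f +h sq_src g) (sq_tgt f +h sq_tgt g);
  rewrite compDr compDl !sq_comm.
Defined.

Definition sq_id a : square a a.
Proof. by exists (idm _) (idm _); rewrite comp1f compf1. Defined.

Definition sq_comp a b c (g : square b c) (f : square a b) : square a c.
Proof.
by exists (sq_src g \oc sq_src f) (sq_tgt g \oc sq_tgt f);
  rewrite compA sq_comm -compA sq_comm compA.
Defined.

Definition arrow_cat : preadd.
Proof.
refine (@Preadd (arrow C) (@square C)
  (fun a b f g => sq_src f =h sq_src g /\ sq_tgt f =h sq_tgt g)
  sq_zero sq_opp sq_add sq_id sq_comp _ _ _ _ _ _ _ _ _ _ _ _ _).
- move=> a b; split=> [f|f g [e1 e2]|f g h [e1 e2] [d1 d2]] //.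
    by split; apply: hsym.
  by rewrite e1 e2.
- by move=> a b f g [e1 e2]; split; apply: hopp_proper.
- by move=> a b f g f' g' [e1 e2] [d1 d2]; split; apply: hadd_proper.
- by move=> a b c f g f' g' [e1 e2] [d1 d2]; split; apply: comp_proper.
- by move=> *; split; apply: haddA.
- by move=> *; split; apply: haddC.
- by move=> *; split; apply: hadd0f.
- by move=> *; split; apply: haddNf.
- by move=> *; split; apply: compA.
- by move=> *; split; apply: comp1f.
- by move=> *; split; apply: compf1.
- by move=> *; split; apply: compDl.
- by move=> *; split; apply: compDr.
Defined.

End ArrowCategory.

(* The finite direct sums of objects of [K]; closed under isomorphism, since
   [x (+) 0] may be any object isomorphic to [x]. *)
Inductive finite_sum (C : preadd) (K : C -> Prop) : C -> Prop :=
| FiniteSum0 z of is_zero z : finite_sum K z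
| FiniteSum1 x of K x : finite_sum K x
| FiniteSum2 x y z of finite_sum K x & finite_sum K y & is_biproduct x y z :
    finite_sum K z.

Definition factors (C : preadd) (K : C -> Prop) (x y : C) (f : hom x y) :=
  exists (k : C) (g : hom x k) (h : hom k y), finite_sum K k /\ f =h h \oc g.

Section Quotient.
Variables (C : additive_cat) (K : C -> Prop).

Lemma factors_eq (x y : C) (f g : hom x y) :
  f =h g -> factors K f -> factors K g.
Proof.
by move=> e [k [u [v [Kk e']]]]; exists k, u, v; rewrite -e.
Qed.

Lemma factors0 (x y : C) : factors K (hzero x y).
Proof.
have [z z0] := has_zero C; exists z, (hzero _ _), (hzero _ _).
by split; [apply: FiniteSum0 | rewrite compf0].
Qed.

Lemma factorsN (x y : C) (f : hom x y) : factors K f -> factors K (hopp f).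
Proof.
by move=> [k [u [v [Kk e]]]]; exists k, u, (hopp v); rewrite e compNf.
Qed.

Lemma factorsD (x y : C) (f g : hom x y) :
  factors K f -> factors K g -> factors K (f +h g).
Proof.
move=> [k [u [v [Kk e]]]] [k' [u' [v' [Kk' e']]]].
have [m km] := has_biproducts k k'.
have [i1 [i2 [p1 [p2 [e11 e22 e12 e21 _]]]]] := km.
exists m, ((i1 \oc u) +h (i2 \oc u')), ((v \oc p1) +h (v' \oc p2)).
split; first exact: FiniteSum2 km.
rewrite compDl !compDr -!compA (compA p1) e11 (compA p1) e12 (compA p2) e21.
by rewrite (compA p2) e22 !comp0f !compf0 !comp1f haddf0 hadd0f e e'.
Qed.

Lemma factors_compl (x y z : C) (g : hom y z) (f : hom x y) :
  factors K f -> factors K (g \oc f).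
Proof.
by move=> [k [u [v [Kk e]]]]; exists k, u, (g \oc v); rewrite e compA.
Qed.

Lemma factors_compr (x y z : C) (g : hom y z) (f : hom x y) :
  factors K g -> factors K (g \oc f).
Proof.
by move=> [k [u [v [Kk e]]]]; exists k, (u \oc f), v; rewrite e compA.
Qed.

Definition quot_eq (x y : C) (f g : hom x y) := factors K (f +h hopp g).

Lemma quot_eqW (x y : C) (f g : hom x y) : f =h g -> quot_eq f g.
Proof.
by move=> e; apply: factors_eq (factors0 x y); rewrite e haddfN.
Qed.

Lemma quot_eq_equiv (x y : C) : Equivalence (@quot_eq x y).
Proof.
split=> [f|f g|f g h]; first exact: quot_eqW.
  move=> /factorsN; apply: factors_eq; apply/hsym/hopp_uniq.
  by rewrite haddACA (haddC (hopp g)) haddACA !haddfN hadd0f.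
move=> e e'; apply: factors_eq (factorsD e e').
by rewrite -haddA (haddA _ g) haddNf hadd0f.
Qed.

Definition quotient_preadd : preadd.
Proof.
refine (@Preadd C (@hom C) quot_eq hzero (@hopp C) (@hadd C) idm (@comp C)
  quot_eq_equiv _ _ _ _ _ _ _ _ _ _ _ _).
- move=> x y f g /factorsN; apply: factors_eq; apply/hsym/hopp_uniq.
  by rewrite haddACA !haddfN hadd0f.
- move=> x y f f' g g' e e'; apply: factors_eq (factorsD e e').
  rewrite haddACA; apply: hadd_proper => //.
  by apply: hopp_uniq; rewrite haddACA !haddfN hadd0f.
- move=> x y z g g' f f' e e'.
  apply: factors_eq (factorsD (factors_compr f e) (factors_compl g' e')).
  rewrite compDl compDr compNf compfN -haddA (haddA (hopp _)) haddNf hadd0f.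
  by [].
- by move=> *; apply/quot_eqW/haddA.
- by move=> *; apply/quot_eqW/haddC.
- by move=> *; apply/quot_eqW/hadd0f.
- by move=> *; apply/quot_eqW/haddNf.
- by move=> *; apply/quot_eqW/compA.
- by move=> *; apply/quot_eqW/comp1f.
- by move=> *; apply/quot_eqW/compf1.
- by move=> *; apply/quot_eqW/compDl.
- by move=> *; apply/quot_eqW/compDr.
Defined.

Definition quotient_cat : additive_cat.
Proof.
exists quotient_preadd.
- by have [z z0] := has_zero C; exists z; apply: quot_eqW.
- move=> x y; have [z [i1 [i2 [p1 [p2 [? ? ? ? ?]]]]]] := has_biproducts x y.
  by exists z, i1, i2, p1, p2; split; apply: quot_eqW.
Defined.

End Quotient.

Definition abcat : preadd.
Proof.
refine (@Preadd zmodType (fun A B => {additive A -> B}) (fun A B f g => f =1 g)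
  (fun A B => \0) (fun A B f => \- f)
  (fun A B f g => f \+ g) (fun A => idfun)
  (fun A B C g f => g \o f) _ _ _ _ _ _ _ _ _ _ _ _ _).
- by move=> A B; split=> [f x|f g e x|f g h e e' x] //; rewrite e ?e'.
- by move=> A B f g e x /=; rewrite e.
- by move=> A B f f' g g' e e' x /=; rewrite e e'.
- by move=> A B C g g' f f' e e' x /=; rewrite e e'.
- by move=> A B f g h x /=; rewrite addrA.
- by move=> A B f g x /=; rewrite addrC.
- by move=> A B f x /=; rewrite add0r.
- by move=> A B f x /=; rewrite addNr.
- by [].
- by [].
- by [].
- by [].
- by move=> A B C g f f' x /=; rewrite raddfD.
Defined.

Section LinearMaps.
Variables (R : pzRingType) (A B : lmodType R).
Let T := {linear A -> B}.

Lemma lin_ext (f g : T) : f =1 g -> f = g.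
Proof.
move=> /funext; case: f => f [[f1] [f2]]; case: g => g [[g1] [g2]] /= e.
by subst g; rewrite (Prop_irrelevance f1 g1) (Prop_irrelevance f2 g2).
Qed.

Let add (f g : T) : T := f \+ g.
Let opp (f : T) : T := \- f.
Let zero : T := \0.

Lemma lin_addA : associative add.
Proof. by move=> f g h; apply: lin_ext => x /=; rewrite addrA. Qed.
Lemma lin_addC : commutative add.
Proof. by move=> f g; apply: lin_ext => x /=; rewrite addrC. Qed.
Lemma lin_add0 : left_id zero add.
Proof. by move=> f; apply: lin_ext => x /=; rewrite add0r. Qed.
Lemma lin_addN : left_inverse zero opp add.
Proof. by move=> f; apply: lin_ext => x /=; rewrite addNr. Qed.

Definition lin_choice : choiceType :=
  HB.pack T (gen_eqMixin T) (gen_choiceMixin T).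

Definition lin_zmod : zmodType :=
  HB.pack T (Choice.class lin_choice)
    (GRing.isZmodule.Build lin_choice lin_addA lin_addC lin_add0 lin_addN).

End LinearMaps.

Section Composition.
Variables (R : pzRingType) (A A' B : lmodType R).

Definition precomp (g : {linear A' -> A}) (f : lin_zmod A B) :
  lin_zmod A' B := (f : {linear A -> B}) \o g.

Fact precomp_morphism g : nmod_morphism (precomp g).
Proof. by split=> [|f f']; apply: lin_ext => x. Qed.

HB.instance Definition _ g := GRing.isNmodMorphism.Build
  (lin_zmod A B) (lin_zmod A' B) (precomp g) (precomp_morphism g).

Definition postcomp (g : {linear A -> A'}) (f : lin_zmod B A) :
  lin_zmod B A' := g \o (f : {linear B -> A}).

Fact postcomp_morphism g : nmod_morphism (postcomp g).
Proof.
by split=> [|f f']; apply: lin_ext => x; rewrite /= (raddf0, raddfD).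
Qed.

HB.instance Definition _ g := GRing.isNmodMorphism.Build
  (lin_zmod B A) (lin_zmod B A') (postcomp g) (postcomp_morphism g).

End Composition.

Section PairMaps.
Variables (A A' B B' : zmodType).

Definition pair_map (f : {additive A -> A'}) (g : {additive B -> B'})
  (u : A * B) : A' * B' := (f u.1, g u.2).

Fact pair_map_morphism f g : nmod_morphism (pair_map f g).
Proof. by split=> [|u v]; rewrite /pair_map /= ?raddf0 ?raddfD. Qed.

HB.instance Definition _ f g := GRing.isNmodMorphism.Build
  (A * B)%type (A' * B')%type (pair_map f g) (pair_map_morphism f g).

Definition pair_l (u : A) : A * B := (u, 0).
Definition pair_r (v : B) : A * B := (0, v).

Fact pair_l_morphism : nmod_morphism pair_l.
Proof. by split=> [|u v] //; congr pair; rewrite addr0. Qed.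

Fact pair_r_morphism : nmod_morphism pair_r.
Proof. by split=> [|u v] //; congr pair; rewrite addr0. Qed.

HB.instance Definition _ :=
  GRing.isNmodMorphism.Build A (A * B)%type pair_l pair_l_morphism.
HB.instance Definition _ :=
  GRing.isNmodMorphism.Build B (A * B)%type pair_r pair_r_morphism.

End PairMaps.

Definition ideal (k : comPzRingType) (I : k -> Prop) :=
  [/\ I 0, forall x y, I x -> I y -> I (x + y) & forall a x, I x -> I (a * x)].

Definition artinian (k : comPzRingType) :=
  forall I : nat -> k -> Prop,
    (forall i, ideal (I i)) -> (forall i x, I i.+1 x -> I i x) ->
    exists m, forall i, (m <= i)%N -> forall x, I m x -> I i x.

(* The ring morphism [phi] is the structure map of the k-algebra [L]; the
   k-module structure of [L] is given by [phi c * x].  The zero ring is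
   allowed, which is why [algType] is not used. *)
Definition artin_algebra (L : pzRingType) :=
  exists (k : comPzRingType) (phi : {rmorphism k -> L}),
    [/\ artinian k,
        forall c x, phi c * x = x * phi c
      & exists s : seq L, forall x, exists c : nat -> k,
          x = \sum_(i < size s) phi (c i) * s`_i].

(* Modules are left modules; right modules over [L] are modules over the
   converse ring [L^c]. *)

Section Modules.
Variable R : pzRingType.

Definition finitely_generated (A : lmodType R) :=
  exists s : seq A, forall x, exists c : nat -> R,
    x = \sum_(i < size s) c i *: s`_i.

Record fgmod := FgMod {
  fg_sort :> lmodType R;
  fg_gen : finitely_generated fg_sort }.

Definition surjective (A B : Type) (f : A -> B) := forall y, exists x, f x = y.

Definition projective (P : lmodType R) :=
  forall (A B : lmodType R) (g : {linear A -> B}) (f : {linear P -> B}),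
    surjective g -> exists h : {linear P -> A}, g \o h =1 f.

Definition modcat : preadd.
Proof.
refine (@Preadd fgmod (fun A B => {linear A -> B}) (fun A B f g => f =1 g)
  (fun A B => \0) (fun A B f => \- f)
  (fun A B f g => f \+ g) (fun A => idfun)
  (fun A B C g f => g \o f) _ _ _ _ _ _ _ _ _ _ _ _ _).
- by move=> A B; split=> [f x|f g e x|f g h e e' x] //; rewrite e ?e'.
- by move=> A B f g e x /=; rewrite e.
- by move=> A B f f' g g' e e' x /=; rewrite e e'.
- by move=> A B C g g' f f' e e' x /=; rewrite e e'.
- by move=> A B f g h x /=; rewrite addrA.
- by move=> A B f g x /=; rewrite addrC.
- by move=> A B f x /=; rewrite add0r.
- by move=> A B f x /=; rewrite addNr.
- by [].
- by [].
- by [].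
- by [].
- by move=> A B C g f f' x /=; rewrite raddfD.
Defined.

Record proj_resolution (A : fgmod) := ProjResolution {
  pr_mod : nat -> fgmod;
  pr_d : forall i, {linear pr_mod i.+1 -> pr_mod i};
  pr_aug : {linear pr_mod 0 -> A};
  pr_proj : forall i, projective (pr_mod i);
  pr_aug_surj : surjective pr_aug;
  pr_exact0 : forall x, pr_aug x = 0 <-> exists y, pr_d 0 y = x;
  pr_exactS : forall i x, pr_d i x = 0 <-> exists y, pr_d i.+1 y = x }.

(* [Ext^i(A, B)] is the cohomology in degree [i] of the complex [Hom(P, B)],
   for a projective resolution [P] of [A] by finitely generated modules.  Its
   vanishing does not depend on [P], and such a [P] exists over an artin
   algebra because it is noetherian. *)
Definition cocycle A B (P : proj_resolution A) i
    (f : {linear pr_mod P i -> fg_sort B}) :=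
  forall x, f (pr_d P i x) = 0.

Definition coboundary A B (P : proj_resolution A) i :
    {linear pr_mod P i -> fg_sort B} -> Prop :=
  match i with
  | 0%N => fun f => f =1 \0
  | j.+1 => fun f => exists g : {linear pr_mod P j -> B}, f =1 g \o pr_d P j
  end.

Definition Ext_eq0 i (A B : fgmod) :=
  forall (P : proj_resolution A) (f : {linear pr_mod P i -> B}),
    cocycle f -> coboundary f.

Record add_subcat := AddSubcat {
  in_sub :> fgmod -> Prop;
  sub_has_zero : exists z : full_sub (C := modcat) in_sub, is_zero z;
  sub_has_biproducts : forall x y : full_sub (C := modcat) in_sub,
    exists z : full_sub (C := modcat) in_sub, is_biproduct x y z }.

Definition right_approx (M : fgmod -> Prop) (A X : fgmod)
    (f : {linear X -> A}) :=
  M X /\ forall X', M X' -> forall g : {linear X' -> A},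
    exists h : {linear X' -> X}, g =1 f \o h.

Definition left_approx (M : fgmod -> Prop) (A X : fgmod)
    (f : {linear A -> X}) :=
  M X /\ forall X', M X' -> forall g : {linear A -> X'},
    exists h : {linear X -> X'}, g =1 h \o f.

Definition functorially_finite (M : fgmod -> Prop) :=
  forall A : fgmod,
    (exists (X : fgmod) (f : {linear X -> A}), right_approx M f) /\
    (exists (X : fgmod) (f : {linear A -> X}), left_approx M f).

Definition generating_cogenerating (M : fgmod -> Prop) :=
  forall A : fgmod,
    (exists (X : fgmod) (f : {linear X -> A}), M X /\ surjective f) /\
    (exists (X : fgmod) (f : {linear A -> X}), M X /\ injective f).

Definition cluster_tilting (n : nat) (M : add_subcat) :=
  [/\ functorially_finite M,
      generating_cogenerating M,
      forall A, M A <->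
        forall X i, M X -> (0 < i < n)%N -> Ext_eq0 i X A
    & forall A, M A <->
        forall X i, M X -> (0 < i < n)%N -> Ext_eq0 i A X].

Section Subcategory.
Variable M : add_subcat.

Definition sub_cat : additive_cat :=
  AdditiveCat (sub_has_zero M) (sub_has_biproducts (a := M)).

Definition sub_mod (X : sub_cat) : fgmod := sval X.
Definition sub_lin (X Y : sub_cat) (f : hom X Y) :
  {linear sub_mod X -> sub_mod Y} := f.

Definition is_mono (a : arrow_cat sub_cat) := injective (sub_lin (arr a)).

Lemma mono_has_zero : exists z : full_sub is_mono, is_zero z.
Proof.
have [z z0] := has_zero sub_cat.
have inj : is_mono (Arrow (idm z)) by [].
by exists (exist _ _ inj); split.
Qed.

Lemma mono_has_biproducts (a b : full_sub is_mono) :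
  exists c : full_sub is_mono, is_biproduct a b c.
Proof.
have [x [i1 [i2 [p1 [p2 [x11 x22 x12 x21 x1]]]]]] :=
  has_biproducts (src (sval a)) (src (sval b)).
have [y [j1 [j2 [q1 [q2 [y11 y22 y12 y21 y1]]]]]] :=
  has_biproducts (tgt (sval a)) (tgt (sval b)).
pose f := arr (sval a); pose g := arr (sval b).
pose h := (j1 \oc f \oc p1) +h (j2 \oc g \oc p2).
have hi1 : h \oc i1 =h j1 \oc f.
  by rewrite compDl -!compA x11 x21 !compf0 haddf0 compf1.
have hi2 : h \oc i2 =h j2 \oc g.
  by rewrite compDl -!compA x12 x22 !compf0 hadd0f compf1.
have qh1 : q1 \oc h =h f \oc p1.
  by rewrite compDr !compA y11 y12 !comp0f haddf0 comp1f.
have qh2 : q2 \oc h =h g \oc p2.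
  by rewrite compDr !compA y21 y22 !comp0f hadd0f comp1f.
have inj : is_mono (Arrow h).
  apply: raddf_inj => z hz.
  have p1z : sub_lin p1 z = 0.
    apply: (svalP a); rewrite raddf0.
    have := qh1 z; rewrite /= => <-.
    by move: hz; rewrite /sub_lin /= => ->; rewrite raddf0.
  have p2z : sub_lin p2 z = 0.
    apply: (svalP b); rewrite raddf0.
    have := qh2 z; rewrite /= => <-.
    by move: hz; rewrite /sub_lin /= => ->; rewrite raddf0.
  have := x1 z; rewrite /= => <-.
  by move: p1z p2z; rewrite /sub_lin => -> ->; rewrite !raddf0 addr0.
exists (exist _ _ inj).
exists (@Square _ (sval a) (Arrow h) i1 j1 hi1),
  (@Square _ (sval b) (Arrow h) i2 j2 hi2),
  (@Square _ (Arrow h) (sval a) p1 q1 (hsym qh1)),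
  (@Square _ (Arrow h) (sval b) p2 q2 (hsym qh2)).
by split; split.
Qed.

Definition mono_cat : additive_cat :=
  AdditiveCat mono_has_zero mono_has_biproducts.

Definition mono_id_or_0 (a : mono_cat) :=
  (exists X : sub_cat, sval a = Arrow (idm X)) \/
  (exists Z X : sub_cat, is_zero Z /\ sval a = Arrow (hzero Z X)).

Definition V_class : mono_cat -> Prop := finite_sum mono_id_or_0.

Definition ab_functors : preadd := funcat (op sub_cat) abcat.

Definition hom_functor (Y : sub_cat) : functor (op sub_cat) abcat.
Proof.
exists (fun X : op sub_cat => lin_zmod (sub_mod X) (sub_mod Y) : abcat)
  (fun X X' (g : @hom (op sub_cat) X X') =>
     (precomp (@sub_lin X' X g) :
        {additive lin_zmod (sub_mod X) (sub_mod Y) ->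
                  lin_zmod (sub_mod X') (sub_mod Y)})).
- move=> X X' g g' e f; apply: lin_ext => x.
  exact: (congr1 (GRing.Linear.sort (f : {linear _ -> _})) (e x)).
- by move=> X f; apply: lin_ext.
- by move=> X X' X'' g g' f; apply: lin_ext.
- by move=> X X' g g' f; apply: lin_ext => x; rewrite /= raddfD.
Defined.

Definition nt_at (F G : ab_functors) (a : hom F G)
    (X : sub_cat) :
  {additive (fobj F X : zmodType) -> (fobj G X : zmodType)} := nt a X.

(* The sequence Hom(-, Y1) -> Hom(-, Y2) -> F -> 0 is exact, objectwise. *)
Definition finitely_presented (F : ab_functors) :=
  exists (Y1 Y2 : sub_cat)
    (a : hom (hom_functor Y1 : ab_functors) (hom_functor Y2))
    (b : hom (hom_functor Y2 : ab_functors) F),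
    forall X : sub_cat, surjective (nt_at b X) /\
      forall u, nt_at b X u = 0 <-> exists v, nt_at a X v = u.

Definition vanishes_on_projectives (F : ab_functors) :=
  forall P : sub_cat, projective (sub_mod P) ->
    forall u : (fobj F P : zmodType), u = 0.

Definition fp_stable (F : ab_functors) :=
  finitely_presented F /\ vanishes_on_projectives F.

Definition hom_functor_map (Y Y' : sub_cat) (g : hom Y Y') :
  nat_trans (hom_functor Y) (hom_functor Y').
Proof.
exists (fun X : op sub_cat => (postcomp (sub_lin g) :
  {additive lin_zmod (sub_mod X) (sub_mod Y) ->
            lin_zmod (sub_mod X) (sub_mod Y')})).
by move=> X X' f u; apply: lin_ext.
Defined.

Lemma fp_stable_has_zero : exists z : full_sub fp_stable, is_zero z.
Proof.
have [z z0] := has_zero sub_cat.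
have h0 (X : sub_cat) (u : lin_zmod (sub_mod X) (sub_mod z)) : u = 0.
  by apply: lin_ext => x; apply: z0.
suff fp : fp_stable (hom_functor z).
  by exists (exist _ _ fp) => X u /=; rewrite [LHS]h0 [RHS]h0.
split; last by move=> P _ u; apply: h0.
exists z, z, (idm _), (idm _) => X; split=> [u|u]; first by exists u.
by split=> _; [exists u | apply: h0].
Qed.

Definition functor_prod (F G : functor (op sub_cat) abcat) :
  functor (op sub_cat) abcat.
Proof.
exists (fun X => ((fobj F X : zmodType) * (fobj G X : zmodType))%type : abcat)
  (fun X X' f => (pair_map (fmap F f) (fmap G f) :
     {additive (fobj F X : zmodType) * (fobj G X : zmodType) ->
               (fobj F X' : zmodType) * (fobj G X' : zmodType)})).
- move=> X X' f g e [u v]; congr (_, _).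
    exact: (fmap_proper F e u).
  exact: (fmap_proper G e v).
- move=> X [u v]; congr (_, _); first exact: (fmap1 F X u).
  exact: (fmap1 G X v).
- move=> X X' X'' g f [u v]; congr (_, _); first exact: (fmap_comp F g f u).
  exact: (fmap_comp G g f v).
- move=> X X' f g [u v]; congr (_, _); first exact: (fmapD F f g u).
  exact: (fmapD G f g v).
Defined.

Lemma sub_ext (X Y : sub_cat) (f g : hom X Y) : f =h g -> f = g.
Proof. exact: lin_ext. Qed.

Section FunctorProd.
Variables F G : functor (op sub_cat) abcat.

Definition prod_i1 : nat_trans F (functor_prod F G).
Proof.
exists (fun X => @pair_l (fobj F X) (fobj G X) :
  {additive (fobj F X : zmodType) -> (fobj F X * fobj G X)%type}).
by move=> X X' f u; congr (_, _); rewrite /= raddf0.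
Defined.

Definition prod_i2 : nat_trans G (functor_prod F G).
Proof.
exists (fun X => @pair_r (fobj F X) (fobj G X) :
  {additive (fobj G X : zmodType) -> (fobj F X * fobj G X)%type}).
by move=> X X' f u; congr (_, _); rewrite /= raddf0.
Defined.

Definition prod_p1 : nat_trans (functor_prod F G) F.
Proof.
by exists (fun X => fst :
  {additive (fobj F X * fobj G X)%type -> (fobj F X : zmodType)}).
Defined.

Definition prod_p2 : nat_trans (functor_prod F G) G.
Proof.
by exists (fun X => snd :
  {additive (fobj F X * fobj G X)%type -> (fobj G X : zmodType)}).
Defined.

Lemma functor_prodP :
  is_biproduct (F : ab_functors) (G : ab_functors)
    (functor_prod F G : ab_functors).
Proof.
exists prod_i1, prod_i2, prod_p1, prod_p2; split=> X //.
by case=> u v; congr (_, _); rewrite /= (addr0, add0r).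
Qed.

Lemma fp_stable_prod :
  fp_stable F -> fp_stable G -> fp_stable (functor_prod F G).
Proof.
move=> [[X1 [X2 [a [b ab]]]] Fv] [[Y1 [Y2 [c [d cd]]]] Gv].
split; last first.
  by move=> P Pp [u v]; congr (_, _); [apply: Fv | apply: Gv].
have [Z1 [i1 [i2 [p1 [p2 [W11 W22 W12 W21 _]]]]]] := has_biproducts X1 Y1.
have [Z2 [j1 [j2 [q1 [q2 [Z11 Z22 Z12 Z21 Z2e]]]]]] := has_biproducts X2 Y2.
pose A1 : nat_trans (hom_functor Z1) (hom_functor Z2) :=
  nt_comp (hom_functor_map j1) (nt_comp a (hom_functor_map p1)).
pose A2 : nat_trans (hom_functor Z1) (hom_functor Z2) :=
  nt_comp (hom_functor_map j2) (nt_comp c (hom_functor_map p2)).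
pose B1 := nt_comp prod_i1 (nt_comp b (hom_functor_map q1)).
pose B2 := nt_comp prod_i2 (nt_comp d (hom_functor_map q2)).
pose A : @hom ab_functors (hom_functor Z1) (hom_functor Z2) := nt_add A1 A2.
pose B : @hom ab_functors (hom_functor Z2) (functor_prod F G) := nt_add B1 B2.
exists Z1, Z2, A, B => X.
pose aX (k : hom X X1) : hom X X2 := nt_at a X k.
pose cX (k : hom X Y1) : hom X Y2 := nt_at c X k.
pose bX (k : hom X X2) : (fobj F X : zmodType) := nt_at b X k.
pose dX (k : hom X Y2) : (fobj G X : zmodType) := nt_at d X k.
have [bs be] := ab X; have [ds de] := cd X.
have AE (k : hom X Z1) : nt_at A X k =
    (j1 \oc aX (p1 \oc k)) +h (j2 \oc cX (p2 \oc k)) by [].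
have BE (h : hom X Z2) : nt_at B X h =
    (bX (q1 \oc h), dX (q2 \oc h)).
  by congr (_, _); rewrite /= (addr0, add0r).
have qj (s : hom X X2) (t : hom X Y2) :
    q1 \oc ((j1 \oc s) +h (j2 \oc t)) = s /\
    q2 \oc ((j1 \oc s) +h (j2 \oc t)) = t.
  split; apply: sub_ext; rewrite compDr !compA.
    by rewrite Z11 Z12 comp1f comp0f haddf0.
  by rewrite Z21 Z22 comp1f comp0f hadd0f.
have pi (s : hom X X1) (t : hom X Y1) :
    p1 \oc ((i1 \oc s) +h (i2 \oc t)) = s /\
    p2 \oc ((i1 \oc s) +h (i2 \oc t)) = t.
  split; apply: sub_ext; rewrite compDr !compA.
    by rewrite W11 W12 comp1f comp0f haddf0.
  by rewrite W21 W22 comp1f comp0f hadd0f.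
split=> [[u v]|h].
  have [s su] := bs u; have [t tv] := ds v.
  exists ((j1 \oc (s : hom X X2)) +h (j2 \oc (t : hom X Y2))).
  rewrite BE; have [-> ->] := qj s t; congr (_, _); [exact: su|exact: tv].
split=> [|[k <-]]; last first.
  rewrite AE BE; have [-> ->] := qj (aX (p1 \oc k)) (cX (p2 \oc k)).
  by congr (_, _); [apply/be; exists (p1 \oc k)|apply/de; exists (p2 \oc k)].
rewrite BE => -[/be [v va] /de [w wc]].
exists ((i1 \oc (v : hom X X1)) +h (i2 \oc (w : hom X Y1))).
rewrite AE; have [-> ->] := pi v w.
rewrite [aX v]va [cX w]wc; apply: sub_ext.
by rewrite !compA -compDl Z2e comp1f.
Qed.

End FunctorProd.

Lemma fp_stable_has_biproducts (F G : full_sub fp_stable) :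
  exists H : full_sub fp_stable, is_biproduct F G H.
Proof.
exists (exist _ _ (fp_stable_prod (svalP F) (svalP G))).
exact: functor_prodP.
Qed.

(* mod-\underline{M}, realised by functors on M (not on its stable quotient)
   vanishing on the projective modules that belong to M. *)
Definition mod_stable : additive_cat :=
  AdditiveCat fp_stable_has_zero fp_stable_has_biproducts.

End Subcategory.
End Modules.

(* Main.v *)
(* Write n = m + 1.  For 0 <= j <= m let E_j be the category of short exact
   sequences 0 -> A -> B -> C -> 0 with B in M, Ext^i(M, A) = 0 for
   0 < i <= m - j and Ext^i(C, M) = 0 for 0 < i <= j, where morphisms are taken
   up to homotopy.  In E_0 the module A lies in M and C is arbitrary, so that
   E_0 is S(M)/V: a square factors through V if and only if its component on
   sources extends along the source monomorphism.  In E_m the module C lies in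
   M and A is arbitrary, and sending a sequence to the cokernel of
   Hom(-, B) -> Hom(-, C) is an equivalence of E_m with the functors in
   mod-M that vanish on projectives.  Finally E_j and E_(j+1) are equivalent:
   0 -> A -> B -> C -> 0 corresponds to 0 -> C -> B' -> C' -> 0 with C -> B' a
   left approximation, or B -> C a right approximation; the orthogonality
   conditions let a morphism C -> C1 extend uniquely, up to homotopy, to both
   sequences. *)

From HB Require Import structures.
From mathcomp Require Import all_boot all_algebra boolp classical_sets.
Require Import Defs.

Set Implicit Arguments.
Unset Strict Implicit.
Unset Printing Implicit Defensive.

Import GRing.Theory.
Local Open Scope ring_scope.

(** * Submodules and quotients *)

(** Each step of the chain trades one degree of left orthogonality for one of right orthogonality,
    so the total m stays constant. Cluster tilting identifies the two ends: m degrees of vanishing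
    mean membership in M, and 0 degrees are no condition. For n = 1 the chain has no step.

    The passage between neighbouring categories depends on chosen approximations and on extensions
    that are not unique, so writing down a functor would require many coherent choices. Instead,
    objects carrying both sequences are introduced, with a relation between morphisms that is total
    on both sides and preserves and reflects null morphisms; choices are made once, in a general
    lemma about such correspondences.

    The artin hypothesis supplies noetherianity, hence kernels and projective resolutions among
    finitely generated modules. Vanishing of Ext is handled by extending maps along short exact
    sequences and by dimension shift, and is then compared with cohomology of resolutions. *)

Section LinearOf.
Variables (R : pzRingType) (A B : lmodType R) (f : A -> B).
Hypothesis lf : linear f.
(** The proof of linearity is an argument of the alias, so that the canonical instance can recover
    it. *)
Definition linear_of_fun of linear f := f.
HB.instance Definition _ :=
  GRing.isLinear.Build R A B *:%R (linear_of_fun lf) lf.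

Lemma linear_of : exists g : {linear A -> B}, g =1 f.
Proof. by exists (linear_of_fun lf). Qed.
End LinearOf.

Lemma linear_pair_l (R : pzRingType) (A B : lmodType R) :
  exists j : {linear A -> (A * B)%type}, j =1 fun x => (x, 0).
Proof.
by apply: linear_of => c x y; congr (_, _); rewrite /= scaler0 addr0.
Qed.

Lemma linear_pair_r (R : pzRingType) (A B : lmodType R) :
  exists j : {linear B -> (A * B)%type}, j =1 fun y => (0, y).
Proof.
by apply: linear_of => c x y; congr (_, _); rewrite /= scaler0 addr0.
Qed.

Definition submodule (R : pzRingType) (A : lmodType R) (N : A -> Prop) :=
  N 0 /\ forall c x y, N x -> N y -> N (c *: x + y).

Section Submodule.
Variables (R : pzRingType) (A : lmodType R) (N : A -> Prop).
Hypothesis sN : submodule N.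

Lemma submoduleD x y : N x -> N y -> N (x + y).
Proof. by move=> Nx Ny; have := sN.2 1 _ _ Nx Ny; rewrite scale1r. Qed.

Lemma submoduleZ c x : N x -> N (c *: x).
Proof. by move=> Nx; have := sN.2 c _ _ Nx sN.1; rewrite addr0. Qed.

Lemma submoduleN x : N x -> N (- x).
Proof. by move=> Nx; rewrite -scaleN1r; apply: submoduleZ. Qed.

Definition submodule_pred of submodule N : pred A := fun x => `[< N x >].

Fact submodule_pred_closed : GRing.submod_closed (submodule_pred sN).
Proof.
split=> [|c x y /asboolP Nx /asboolP Ny]; apply/asboolP; first exact: sN.1.
exact: sN.2.
Qed.

HB.instance Definition _ :=
  GRing.isSubmodClosed.Build R A (submodule_pred sN) submodule_pred_closed.

Definition submodule_type := {x | x \in submodule_pred sN}.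
HB.instance Definition _ := SubChoice.on submodule_type.
HB.instance Definition _ := [SubChoice_isSubLmodule of submodule_type by <:].

Lemma submodule_object :
  exists (K : lmodType R) (k : {linear K -> A}),
    injective k /\ forall x, N x <-> exists y, k y = x.
Proof.
exists submodule_type, (val : {linear submodule_type -> A}).
split; first exact: val_inj.
move=> x; split=> [/asboolP Nx|[y <-]]; last exact/asboolP/(valP y).
by exists (exist _ x Nx).
Qed.

End Submodule.

Section ZmodQuotient.
Variables (V : zmodType) (N : V -> Prop).
Definition subgroup := N 0 /\ forall x y, N x -> N y -> N (x - y).
Hypothesis sN : subgroup.

Definition subgroup_pred of subgroup : pred V := fun x => `[< N x >].

Fact subgroup_pred_closed : zmod_closed (subgroup_pred sN).
Proof.
split=> [|x y /asboolP Nx /asboolP Ny]; apply/asboolP; first exact: sN.1.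
exact: sN.2.
Qed.

HB.instance Definition _ :=
  GRing.isZmodClosed.Build V (subgroup_pred sN) subgroup_pred_closed.

Lemma zmod_quotient :
  exists (Q : zmodType) (p : {additive V -> Q}),
    surjective p /\ forall x, p x = 0 <-> N x.
Proof.
pose Q := Quotient.quot (GRing.ZmodClosed.clone V (subgroup_pred sN) _).
exists Q, (\pi_Q)%qT.
split=> [y|x].
  by exists (generic_quotient.repr y); apply: generic_quotient.reprK.
rewrite -[X in X <-> _]/(_ = 0) -(raddf0 (\pi_Q)%qT); split.
  move=> /eqP; rewrite -Quotient.idealrBE subr0 => /asboolP //.
by move=> Nx; apply/eqP; rewrite -Quotient.idealrBE subr0; apply/asboolP.
Qed.
End ZmodQuotient.

Section ScaleModule.
Variables (R : pzRingType) (V : zmodType) (sc : R -> V -> V).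
Hypotheses (scA : forall a b v, sc a (sc b v) = sc (a * b) v)
  (sc1 : left_id 1 sc) (scDr : right_distributive sc +%R)
  (scDl : forall v a b, sc (a + b) v = sc a v + sc b v).

(** The phantom ties the type to [sc], keeping this scaling apart from any other module structure on
    the same group. *)
Definition scale_module_type of phantom (R -> V -> V) sc :=
  GRing.Zmodule.sort V.
Local Notation T := (scale_module_type (Phantom _ sc)).
HB.instance Definition _ := GRing.Zmodule.on T.
HB.instance Definition _ :=
  GRing.Zmodule_isLmodule.Build R T scA sc1 scDr scDl.
Definition scale_module : lmodType R := T.
End ScaleModule.

(** The group quotient is scaled through chosen representatives [s q]; stability of [N] under
    scaling makes the result independent of the choice. *)
Lemma quotient_module (R : pzRingType) (A : lmodType R) (N : A -> Prop) :
    submodule N ->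
  exists (Q : lmodType R) (p : {linear A -> Q}),
    surjective p /\ forall x, p x = 0 <-> N x.
Proof.
move=> sN.
have [|Q [p [ps pN]]] := @zmod_quotient A N.
  split=> [|x y Nx Ny]; first exact: sN.1.
  by apply: submoduleD => //; apply: submoduleN.
have pE x y : N (x - y) -> p x = p y.
  by move=> /pN; rewrite raddfB => /subr0_eq.
have [s sE] := choice ps.
pose sc (c : R) (q : Q) := p (c *: s q).
have scE c x : sc c (p x) = p (c *: x).
  apply: pE; rewrite -scalerBr; apply: submoduleZ => //.
  by apply/pN; rewrite raddfB sE subrr.
have scA a b v : sc a (sc b v) = sc (a * b) v.
  by have [x <-] := ps v; rewrite !scE scalerA.
have sc1 v : sc 1 v = v.
  by have [x <-] := ps v; rewrite !scE scale1r.
have scDr : right_distributive sc +%R.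
  move=> c u v; have [x <-] := ps u; have [y <-] := ps v.
  by rewrite -raddfD !scE scalerDr raddfD.
have scDl v a b : sc (a + b) v = sc a v + sc b v.
  by have [x <-] := ps v; rewrite !scE scalerDl raddfD.
pose QM := scale_module scA sc1 scDr scDl.
have lp : linear (p : A -> QM).
  by move=> c x y; rewrite raddfD -scE.
have [g gE] := linear_of lp.
exists QM, g; split=> [y|x]; rewrite ?gE //.
by have [x xy] := ps y; exists x; rewrite gE.
Qed.

Lemma lift_through_mono (R : pzRingType) (A B C : lmodType R)
    (i : {linear A -> B}) (f : {linear C -> B}) :
    injective i -> (forall x, exists y, i y = f x) ->
  exists h : {linear C -> A}, forall x, i (h x) = f x.
Proof.
move=> inj /choice[h hE].
have [|g gE] := @linear_of R C A h; last by exists g => x; rewrite gE.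
by move=> c x y; apply: inj; rewrite hE !linearP !hE.
Qed.

Lemma descend_along_epi (R : pzRingType) (A B C : lmodType R)
    (p : {linear A -> B}) (f : {linear A -> C}) :
    surjective p -> (forall x, p x = 0 -> f x = 0) ->
  exists h : {linear B -> C}, forall x, h (p x) = f x.
Proof.
move=> /choice[s sE] kf.
have fE x y : p x = p y -> f x = f y.
  by move=> e; apply/eqP; rewrite -subr_eq0 -linearB kf // linearB e subrr.
have [|g gE] := @linear_of R B C (f \o s); last first.
  by exists g => x; rewrite gE; apply: fE; rewrite sE.
by move=> c x y /=; rewrite -linearP; apply: fE; rewrite linearP !sE.
Qed.

(** * Modules over an artin algebra are noetherian *)

Section Span.
Variable R : pzRingType.
Implicit Types A B : lmodType R.

(** Recursion on the list lets inductions peel off one generator; [span_sum] and [sum_span]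
    translate to sums. *)
Fixpoint span A (s : seq A) (x : A) : Prop :=
  if s is a :: s' then exists c, span s' (x - c *: a) else x = 0.

Definition fg_sub A (N : A -> Prop) := exists s, forall x, N x <-> span s x.

Definition noetherian A := forall N : A -> Prop, submodule N -> fg_sub N.

Lemma submodule_sum A (N : A -> Prop) n (F : nat -> A) : submodule N ->
  (forall i, (i < n)%N -> N (F i)) -> N (\sum_(i < n) F i).
Proof.
move=> sN NF; elim/big_ind: _ => [|x y|[i i_n] _]; first exact: sN.1.
  exact: submoduleD.
exact: NF.
Qed.

Lemma span_submodule A (s : seq A) : submodule (span s).
Proof.
elim: s => [|a s [IH0 IH]] /=.
  by split=> // c x y -> ->; rewrite scaler0 addr0.
split=> [|c x y [d xd] [e ye]]; first by exists 0; rewrite scale0r subr0.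
exists (c * d + e); rewrite scalerDl -scalerA opprD addrACA -scalerBr.
exact: IH.
Qed.

Lemma span_mem A (s : seq A) x : x \in s -> span s x.
Proof.
elim: s => //= a s IH; rewrite in_cons => /orP[/eqP->|/IH xs].
  by exists 1; rewrite scale1r subrr; apply: (span_submodule s).1.
by exists 0; rewrite scale0r subr0.
Qed.

Lemma span_min A (s : seq A) (N : A -> Prop) :
  submodule N -> (forall x, x \in s -> N x) -> forall x, span s x -> N x.
Proof.
move=> sN; elim: s => [_ x ->|a s IH Ns x [c xc]]; first exact: sN.1.
rewrite -(subrK (c *: a) x); apply: (submoduleD sN).
  by apply: IH xc => y ys; apply: Ns; rewrite in_cons ys orbT.
by apply: (submoduleZ sN); apply: Ns; rewrite in_cons eqxx.
Qed.

Lemma span_catl A (s t : seq A) x : span s x -> span (s ++ t) x.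
Proof.
apply: span_min; first exact: span_submodule.
by move=> y ys; apply: span_mem; rewrite mem_cat ys.
Qed.

Lemma span_catr A (s t : seq A) x : span t x -> span (s ++ t) x.
Proof.
apply: span_min; first exact: span_submodule.
by move=> y yt; apply: span_mem; rewrite mem_cat yt orbT.
Qed.

Lemma span_sum A (s : seq A) x :
  span s x -> exists c : nat -> R, x = \sum_(i < size s) c i *: s`_i.
Proof.
elim: s x => [x ->|a s IH x [c /IH[d xd]]].
  by exists (fun=> 0); rewrite big_ord0.
exists (fun i => if i is j.+1 then d j else c).
by rewrite big_ord_recl /= -xd addrC subrK.
Qed.

Lemma sum_span A (s : seq A) (c : nat -> R) :
  span s (\sum_(i < size s) c i *: s`_i).
Proof.
apply: (submodule_sum (F := fun i => c i *: s`_i)) => [|i i_s].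
  exact: span_submodule.
by apply: submoduleZ; [apply: span_submodule|apply/span_mem/mem_nth].
Qed.

Lemma span_map A B (f : {linear A -> B}) s y :
  span (map f s) y <-> exists2 x, span s x & f x = y.
Proof.
elim: s y => [y|a s IH y] /=.
  by split=> [->|[x -> <-]]; [exists 0; rewrite ?linear0|rewrite linear0].
split=> [[c /IH[x sx xy]]|[x [c sx] <-]].
  exists (x + c *: a); first by exists c; rewrite addrK.
  by rewrite linearD linearZ_LR xy subrK.
by exists c; apply/IH; exists (x - c *: a); rewrite // linearB linearZ_LR.
Qed.

Lemma fg_sub_image A B (f : {linear A -> B}) (N : A -> Prop) :
  fg_sub N -> fg_sub (fun y => exists2 x, N x & f x = y).
Proof.
move=> [s sN]; exists (map f s) => y; rewrite span_map.
by split=> -[x /sN ? <-]; exists x.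
Qed.

Lemma lift_seq A B (f : A -> B) (N : A -> Prop) (s : seq B) :
  (forall y, y \in s -> exists2 x, N x & f x = y) ->
  exists2 t, map f t = s & forall x, x \in t -> N x.
Proof.
elim: s => [_|y s IH h]; first by exists [::].
have [|t <- tN] := IH; first by move=> z zs; apply: h; rewrite in_cons zs orbT.
have [|x Nx <-] := h y; first by rewrite in_cons eqxx.
by exists (x :: t) => // z; rewrite in_cons => /orP[/eqP->|/tN].
Qed.

Lemma fg_sub_extension A B (f : {linear A -> B}) (N : A -> Prop) :
    submodule N -> fg_sub (fun y => exists2 x, N x & f x = y) ->
    fg_sub (fun x => N x /\ f x = 0) ->
  fg_sub N.
Proof.
move=> sN [s sI] [u uK].
have [|t ts tN] := @lift_seq _ _ f N s; first by move=> y /span_mem/sI.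
exists (t ++ u) => x; split=> [Nx|].
  have /sI : exists2 x', N x' & f x' = f x by exists x.
  rewrite -ts span_map => -[y ty fy].
  rewrite -(subrK y x); apply: submoduleD; [exact: span_submodule| |].
    apply/span_catr/uK; rewrite linearB fy subrr; split=> //.
    by apply: submoduleD => //; apply: submoduleN => //; apply: span_min ty.
  exact: span_catl.
apply: span_min => // y; rewrite mem_cat => /orP[/tN //|/span_mem/uK].
by case.
Qed.

(** The coefficient of [a] in an element is not unique, so [N] is replaced by the module [G] of
    pairs of an element and an admissible coefficient. The coefficients form a left ideal, the pairs
    with coefficient 0 come from the part of [N] inside [span s], and [N] is the image of [G]. *)
Lemma noetherian_span A (s : seq A) : noetherian R^o ->
  (forall x, span s x) -> noetherian A.
Proof.
move=> nR sA N sN.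
(* Only [N] has to lie in the span: a shorter list no longer generates [A]. *)
have : forall x, N x -> span s x by [].
elim: s {sA} N sN => [|a s IH] N sN Ns.
  by exists [::] => x; split=> [/Ns //|->]; apply: sN.1.
pose G (u : A * R^o) := N u.1 /\ span s (u.1 - (u.2 : R) *: a).
have sG : submodule G.
  split=> [|c [x d] [y e] [/= Nx xd] [/= Ny ye]]; split=> /=.
  - exact: sN.1.
  - by rewrite scale0r subr0; apply: (span_submodule s).1.
  - exact: sN.2.
  - rewrite scalerDl -scalerA opprD addrACA -scalerBr.
    exact: (span_submodule s).2.
have sI : submodule (fun c : R^o => exists2 u, G u & u.2 = c).
  split=> [|c x y [u Gu <-] [v Gv <-]]; first by exists 0; first exact: sG.1.
  by exists (c *: u + v); first exact: sG.2.
have [j jE] := linear_pair_l A R^o.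
have fgG : fg_sub G.
  apply: (fg_sub_extension (f := (snd : {linear (A * R^o)%type -> R^o}))) => //.
    exact: nR.
  have [] := IH (fun x => N x /\ span s x).
  - split=> [|c x y [Nx sx] [Ny sy]].
      by split; [apply: sN.1|apply: (span_submodule s).1].
    by split; [apply: sN.2|apply: (span_submodule s).2].
  - by move=> x [].
  move=> t tE; exists (map j t) => u; rewrite span_map; split.
    case: u => x c [[/= Nx xs] c0]; exists x; last by rewrite jE c0.
    by apply/tE; split=> //; move: xs; rewrite c0 scale0r subr0.
  by move=> [x /tE[Nx sx] <-]; rewrite jE; do 2!split=> //=;
    rewrite scale0r subr0.
have [t tE] := fg_sub_image (fst : {linear (A * R^o)%type -> A}) fgG.
exists t => x; rewrite -tE; split=> [Nx|[u [Nu _] <-] //].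
by have [c xc] := Ns x Nx; exists (x, c).
Qed.

End Span.

(** Without a minimal ideal, every ideal with [P] has a strictly smaller one, and iterating a choice
    of these gives a chain that never stabilises. *)
Lemma artinian_min (k : comPzRingType) (P : (k -> Prop) -> Prop)
    (I0 : k -> Prop) :
    artinian k -> ideal I0 -> P I0 ->
  exists K, [/\ ideal K, P K & forall J, ideal J -> P J ->
    (forall x, J x -> K x) -> forall x, K x -> J x].
Proof.
move=> ak iI0 PI0; apply: contrapT => nmin.
pose T := {I : k -> Prop | ideal I /\ P I}.
have step (I : T) : exists J : T, (forall x, sval J x -> sval I x) /\
    ~ (forall x, sval I x -> sval J x).
  case: I => I [iI PI] /=; apply: contrapT => nJ; apply: nmin.
  exists I; split=> // J iJ PJ JI; apply: contrapT => nIJ; apply: nJ.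
  by exists (exist _ J (conj iJ PJ)).
have [f fE] := choice step.
pose I i := iter i f (exist _ I0 (conj iI0 PI0)).
have [||m mE] := ak (fun i => sval (I i)).
- by move=> i; case: (svalP (I i)).
- by move=> i; apply: (fE (I i)).1.
by apply: (fE (I m)).2 => x; apply: (mE m.+1).
Qed.

Section ArtinianNoetherian.
Variable k : comPzRingType.
Hypothesis ak : artinian k.

Lemma ideal_submodule (I : k -> Prop) :
  ideal I <-> submodule (I : k^o -> Prop).
Proof.
split=> [[I0 ID IM]|sI]; first by split=> // c x y Ix Iy; apply/ID/Iy/IM.
split; first exact: sI.1.
  by move=> x y; apply: (submoduleD sI).
by move=> a x; apply: (submoduleZ sI).
Qed.

(* A minimal ideal [K] that is not finitely generated satisfies [y K = 0] or
   [y K = K] for every [y], so that it is a vector space over a field; by Zorn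
   it has a hyperplane, which is finitely generated by minimality. *)
Lemma artinian_noetherian : noetherian k^o.
Proof.
move=> N sN; apply: contrapT => nfgN.
have [|K [/ideal_submodule sK nfgK minK]] :=
    @artinian_min k (fun I => ~ @fg_sub k k^o I) N ak _ nfgN.
  exact/ideal_submodule.
have fgJ (J : k^o -> Prop) v : submodule J -> (forall x, J x -> K x) ->
    K v -> ~ J v -> fg_sub J.
  move=> sJ JK Kv Jv; apply: contrapT => nfgJ; apply: Jv.
  by apply: minK Kv => //; apply/ideal_submodule.
(* If the kernel and the image of multiplication by [y] on [K] are both proper, both are finitely
   generated by minimality, and so is their extension [K]. *)
have K01 y : (forall x, K x -> y * x = 0) \/
    (forall x, K x -> exists2 x', K x' & y * x' = x).
  apply: contrapT => /not_orP[/existsNP[u /not_implyP[Ku yu]]].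
  move=> /existsNP[v /not_implyP[Kv yv]]; apply: nfgK.
  have [f fE] : exists f : {linear k^o -> k^o}, f =1 ( *%R y).
    apply: linear_of => c x z; rewrite mulrDr; congr (_ + _).
    by rewrite /GRing.scale /= mulrCA.
  apply: (fg_sub_extension (f := f)) => //.
    apply: (fgJ _ v) => //.
    - split=> [|c _ _ [x Kx <-] [z Kz <-]].
        by exists 0; [apply: sK.1|rewrite linear0].
      by exists (c *: x + z); [apply: sK.2|rewrite linearP].
    - by move=> _ [x Kx <-]; rewrite fE; apply: (submoduleZ sK).
    - by case=> x Kx; rewrite fE => xv; apply: yv; exists x.
  apply: (fgJ _ u) => //.
  - split=> [|c x z [Kx fx] [Kz fz]].
      by split; [apply: sK.1|rewrite linear0].
    by split; [apply: sK.2|rewrite linearP fx fz scaler0 addr0].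
  - by move=> x [].
  - by rewrite fE; case.
(* The ideals generated by powers of [y] stabilise, so [y ^+ m = c * y ^+ m.+1]. Every element of
   [K] has the form [y ^+ m * w], hence [c] inverts [y] on [K]. *)
have Kinv y : ~ (forall x, K x -> y * x = 0) ->
    exists z, forall x, K x -> z * y * x = x.
  move=> ny; have [//|yK] := K01 y.
  have [||m mE] := ak (I := fun i x => exists c, x = c * y ^+ i).
  - move=> i; split=> [|_ _ [c ->] [d ->]|a _ [c ->]].
    + by exists 0; rewrite mul0r.
    + by exists (c + d); rewrite mulrDl.
    + by exists (a * c); rewrite mulrA.
  - by move=> i _ [c ->]; exists (c * y); rewrite exprS mulrA.
  have [|c yc] := mE m.+1 (leqnSn m) (y ^+ m); first by exists 1; rewrite mul1r.
  have ymK i x : K x -> exists2 x', K x' & y ^+ i * x' = x.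
    elim: i x => [|i IH] x Kx; first by exists x; rewrite ?mul1r.
    have [z /IH[w Kw <-] <-] := yK x Kx.
    by exists w; rewrite // exprS mulrA.
  exists c => x /(ymK m)[w _ <-].
  by rewrite {2}yc exprS !mulrA.
have [v Kv v0] : exists2 v, K v & v != 0.
  apply: contrapT => K0; apply: nfgK; exists [::] => x; split=> /= [Kx|->].
    by apply: contrapT => /eqP x0; apply: K0; exists x.
  exact: sK.1.
(* Membership of 0 is left out because Zorn's lemma also asks for the union of the empty chain; [W0]
   recovers it for the maximal [W]. *)
pose P (W : set k^o) := [/\ forall c x y, W x -> W y -> W (c *: x + y),
  forall x, W x -> K x & ~ W v].
have [F FP totF|W [[WZ WK Wv] maxW]] := @Zorn_bigcup k^o P.
  split=> [c x y [X FX Xx] [Y FY Yy]|x [X /FP[_ XK _] /XK //]|];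
    last by move=> [X /FP[_ _ Xv]].
  have [XY|YX] := totF _ _ FX FY.
    by exists Y => //; case: (FP _ FY) => + _ _; apply=> //; apply: XY.
  by exists X => //; case: (FP _ FX) => + _ _; apply=> //; apply: YX.
have W0 : W 0.
  have [[w Ww]|Wn] := pselect (exists w, W w).
    by have := WZ (-1) _ _ Ww Ww; rewrite scaleN1r addNr.
  case: (maxW (fun x => x = 0)).
    split=> [x Wx|]; first by case: Wn; exists x.
    by move=> h; apply: Wn; exists 0; apply: h.
  split=> [c x y -> ->|x ->|/eqP]; first by rewrite scaler0 addr0.
    exact: sK.1.
  by rewrite (negPf v0).
have sW : submodule W by [].
have [s sE] := fgJ W v sW WK Kv Wv.
apply: nfgK; exists (v :: s) => x; split=> [Kx|]; last first.
  by apply: span_min => // y; rewrite in_cons => /orP[/eqP->//|/span_mem/sE/WK].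
have [Wx|Wx] := pselect (W x).
  by exists 0; rewrite scale0r subr0; apply/sE.
(* By maximality, adjoining [x] to [W] captures [v]. The coefficient [c] cannot annihilate [K],
   since [v] would then lie in [W]; so it is invertible on [K], and [x] is a multiple of [v] modulo
   [W]. *)
have [c [w Ww vE]] : exists c, exists2 w, W w & v = w + c * x.
  apply: contrapT => nv.
  case: (maxW (fun y => exists c, exists2 w, W w & y = w + c * x)).
    split=> [w Ww|h]; first by exists 0, w; rewrite // mul0r addr0.
    by apply: Wx; apply: h; exists 1, 0; rewrite // mul1r add0r.
  split=> [c _ _ [d [w Ww ->]] [e [w' Ww' ->]]|_ [c [w Ww ->]]|//].
    exists (c * d + e), (c *: w + w'); first exact: WZ.
    by rewrite scalerDr addrACA mulrDl -mulrA.
  by apply: (submoduleD sK); [apply: WK|apply: (submoduleZ sK)].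
have [|z zE] := Kinv c.
  by move=> cK; apply: Wv; rewrite vE cK // addr0.
exists z; apply/sE.
have -> : x - z *: (v : k^o) = - (z *: w).
  rewrite vE scalerDr opprD addrCA.
  have -> : z *: (c * x : k^o) = x by rewrite -[RHS]zE // -mulrA.
  by rewrite subrr addr0.
by apply: (submoduleN sW); apply: (submoduleZ sW).
Qed.

End ArtinianNoetherian.

(** Products of generators of [L] over [k] with generators of [A] generate [A] over [k]. Submodules
    over [L^c] are submodules over [k], and generators over [k] still generate over [L^c]. *)
Lemma artin_algebra_noetherian (L : pzRingType) (A : fgmod L^c) :
  artin_algebra L -> noetherian A.
Proof.
move=> [k [phi [ak phiC [t tE]]]] N sN.
pose sc (c : k) (x : A) := (phi c : L^c) *: x.
have scA a b x : sc a (sc b x) = sc (a * b) x.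
  by rewrite /sc scalerA mulrC rmorphM.
have sc1 : left_id 1 sc by move=> x; rewrite /sc rmorph1 scale1r.
have scDr : right_distributive sc +%R by move=> c x y; apply: scalerDr.
have scDl x a b : sc (a + b) x = sc a x + sc b x.
  by rewrite /sc rmorphD scalerDl.
pose Ak : lmodType k := scale_module scA sc1 scDr scDl.
have subk (S : A -> Prop) : submodule S -> @submodule k Ak S.
  by move=> sS; split=> [|c x y]; [apply: sS.1|apply: sS.2].
have [s sE] := fg_gen A.
pose w : seq Ak := [seq (b : L^c) *: a | a <- s, b <- t].
have gen (x : Ak) : span w x.
  have sub : submodule (span w) by apply: span_submodule.
  have [c ->] := sE x.
  apply: (submodule_sum (A := Ak) (F := fun i => c i *: s`_i)) => // i i_s.
  have [d ->] := tE (c i); rewrite scaler_suml.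
  apply: (submodule_sum (A := Ak)
    (F := fun j => ((phi (d j) * t`_j)%R : L^c) *: s`_i)) => // j j_t.
  (* Multiplication is reversed in [L^c], so centrality of [phi] is what brings the scalar from [k]
     to the outside. *)
  have -> : ((phi (d j) * t`_j : L) : L^c) *: s`_i =
      (d j *: ((t`_j : L^c) *: s`_i : Ak))%R.
    by rewrite phiC -scalerA.
  apply: submoduleZ => //; apply: span_mem.
  by apply: allpairs_f; apply: mem_nth.
have [u uE] := noetherian_span (artinian_noetherian ak) gen (subk _ sN).
exists u => x; split=> [/uE|].
  apply: (@span_min k Ak); first exact/subk/span_submodule.
  exact: (@span_mem L^c A u).
by apply: span_min => // y yu; apply/uE/span_mem.
Qed.

(** * Vanishing of Ext and long exact sequences *)

Section FgModules.
Variable R : pzRingType.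
Implicit Types A B C D K P Q X KA KB KC : fgmod R.

Lemma finitely_generatedP (A : lmodType R) :
  finitely_generated A <-> exists s : seq A, forall x, span s x.
Proof.
split=> -[s sE]; exists s => x; last exact/span_sum/sE.
by have [c ->] := sE x; apply: sum_span.
Qed.

Lemma finitely_generated_image (A B : lmodType R) (p : {linear A -> B}) :
  surjective p -> finitely_generated A -> finitely_generated B.
Proof.
move=> ps /finitely_generatedP[s sE]; apply/finitely_generatedP.
exists (map p s) => y; have [x <-] := ps y.
by apply/span_map; exists x.
Qed.

Lemma finitely_generated_prod (A B : lmodType R) :
  finitely_generated A -> finitely_generated B ->
  finitely_generated (A * B)%type.
Proof.
move=> /finitely_generatedP[s sE] /finitely_generatedP[t tE].
apply/finitely_generatedP.
have [f fE] := linear_pair_l A B; have [g gE] := linear_pair_r A B.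
exists (map f s ++ map g t) => -[x y].
have -> : (x, y) = f x + g y.
  by rewrite fE gE; congr (_, _); rewrite /= ?addr0 ?add0r.
apply: submoduleD; first exact: span_submodule.
  by apply/span_catl/span_map; exists x.
by apply/span_catr/span_map; exists y.
Qed.

Definition fg_prod A B : fgmod R :=
  FgMod (finitely_generated_prod (fg_gen A) (fg_gen B)).

Definition short_exact (A B C : lmodType R)
    (i : {linear A -> B}) (p : {linear B -> C}) :=
  [/\ injective i, surjective p & forall x, p x = 0 <-> exists y, i y = x].

Section ShortExact.
Variables (A B C : lmodType R) (i : {linear A -> B}) (p : {linear B -> C}).
Hypothesis ses : short_exact i p.

Lemma short_exact0 x : p (i x) = 0.
Proof. by have [_ _ h] := ses; apply/h; exists x. Qed.

Lemma lift_through_kernel (X : lmodType R) (f : {linear X -> B}) :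
  (forall x, p (f x) = 0) ->
  exists h : {linear X -> A}, forall x, i (h x) = f x.
Proof.
have [inj _ e] := ses => pf.
by apply: lift_through_mono => // x; apply/e.
Qed.

Lemma descend_to_cokernel (X : lmodType R) (f : {linear B -> X}) :
  (forall x, f (i x) = 0) ->
  exists h : {linear C -> X}, forall x, h (p x) = f x.
Proof.
have [_ ps e] := ses => fi.
by apply: descend_along_epi => // x /e[y <-].
Qed.
End ShortExact.

Lemma cokernel_object A B (i : {linear A -> B}) : injective i ->
  exists C (p : {linear B -> C}), short_exact i p.
Proof.
move=> inj.
have [|C [p [ps pN]]] := @quotient_module R B (fun x => exists y, i y = x).
  split=> [|c _ _ [x <-] [y <-]]; first by exists 0; rewrite linear0.
  by exists (c *: x + y); rewrite linearP.
by exists (FgMod (finitely_generated_image ps (fg_gen B))), p.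
Qed.

Lemma projective_prod P Q :
  projective P -> projective Q -> projective (fg_prod P Q).
Proof.
move=> pP pQ A B g f gs.
have [j1 j1E] := linear_pair_l P Q; have [j2 j2E] := linear_pair_r P Q.
have [h1 h1E] := pP A B g (f \o j1) gs.
have [h2 h2E] := pQ A B g (f \o j2) gs.
exists ((h1 \o fst) \+ (h2 \o snd)) => -[x y] /=.
rewrite linearD.
have /= -> := h1E x; have /= -> := h2E y.
rewrite -linearD j1E j2E; congr (f _).
by congr (_, _); rewrite /= ?addr0 ?add0r.
Qed.

Lemma projective_retract (P Q : lmodType R)
    (i : {linear Q -> P}) (r : {linear P -> Q}) :
  cancel i r -> projective P -> projective Q.
Proof.
move=> ir pP A B g f gs; have [h hE] := pP A B g (f \o r) gs.
by exists (h \o i) => x /=; have /= -> := hE (i x); rewrite ir.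
Qed.

(** * Free modules of finite rank *)

Section Free.
Variable n : nat.
Notation F := 'rV[R]_n.

Lemma free_map (A : lmodType R) (a : 'I_n -> A) :
  exists h : {linear F -> A}, forall i, h (delta_mx 0 i) = a i.
Proof.
have [h hE] : exists h : {linear F -> A}, h =1 fun x => \sum_i x 0 i *: a i.
  apply: linear_of => c x y; rewrite scaler_sumr -big_split /=.
  by apply: eq_bigr => i _; rewrite !mxE scalerDl scalerA.
exists h => i; rewrite hE (bigD1 i) //= big1 ?addr0; last first.
  by move=> j ji; rewrite mxE eqxx (negPf ji) scale0r.
by rewrite mxE !eqxx scale1r.
Qed.

Lemma free_ext (A : lmodType R) (f g : {linear F -> A}) :
  (forall i, f (delta_mx 0 i) = g (delta_mx 0 i)) -> f =1 g.
Proof.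
move=> fg x; rewrite [x]row_sum_delta !linear_sum; apply: eq_bigr => i _.
by rewrite !linearZ_LR fg.
Qed.

Lemma free_projective : projective F.
Proof.
move=> A B g f gs; have [s sE] := choice gs.
have [h hE] := free_map (fun i => s (f (delta_mx 0 i))).
by exists h; apply: free_ext => i /=; rewrite hE sE.
Qed.

Lemma free_finitely_generated : finitely_generated F.
Proof.
apply/finitely_generatedP; exists [seq delta_mx 0 i | i <- enum 'I_n] => x.
rewrite [x]row_sum_delta; elim/big_ind: _ => [|y z|i _].
- exact: (span_submodule _).1.
- by apply: submoduleD; apply: span_submodule.
apply: submoduleZ; first exact: span_submodule.
by apply: span_mem; apply: map_f; rewrite mem_enum.
Qed.
End Free.

(** No minimality is meant: any epimorphism from a finitely generated projective will do. *)
Lemma projective_cover A :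
  exists P (p : {linear P -> A}), projective P /\ surjective p.
Proof.
have [s sE] := (finitely_generatedP A).1 (fg_gen A).
have [p pE] := @free_map (size s) A (fun i => s`_i).
exists (FgMod (free_finitely_generated (size s))), p.
split=> [|y]; first exact: free_projective.
have [c ->] := span_sum (sE y).
exists (\sum_(i < size s) c i *: delta_mx 0 i).
by rewrite linear_sum; apply: eq_bigr => i _; rewrite linearZ_LR pE.
Qed.

(* [ext_vanishes i X A] says that Ext^(i+1)(X, A) = 0: note the shift. *)
Fixpoint ext_vanishes i X A : Prop :=
  match i with
  | 0 => forall K B (k : {linear K -> B}) (p : {linear B -> X}),
      short_exact k p -> forall u : {linear K -> A},
      exists v : {linear B -> A}, forall x, v (k x) = u x
  | j.+1 => forall K P (k : {linear K -> P}) (p : {linear P -> X}),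
      projective P -> short_exact k p -> ext_vanishes j K A
  end.

Lemma projective_retraction K B P (k : {linear K -> B}) (p : {linear B -> P}) :
  projective P -> short_exact k p -> exists r : {linear B -> K}, cancel k r.
Proof.
move=> pP ses; have [inj ps _] := ses; have [s sE] := pP _ _ p idfun ps.
have [|r rE] := lift_through_kernel ses (f := idfun \- (s \o p)).
  by move=> x /=; rewrite linearB; have /= -> := sE (p x); rewrite subrr.
exists r => x; apply: inj.
by rewrite rE /= (short_exact0 ses) linear0 subr0.
Qed.

Lemma ext_vanishes_projective i P A : projective P -> ext_vanishes i P A.
Proof.
elim: i P => [|i IH] P pP K B k p /=.
  move=> ses u; have [r kr] := projective_retraction pP ses.
  by exists (u \o r) => x /=; rewrite kr.
move=> pB ses; have [r kr] := projective_retraction pP ses.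
exact/IH/projective_retract/pB/kr.
Qed.

Section Noetherian.
Hypothesis noeth : forall A : fgmod R, noetherian A.

(** Noetherianity keeps the kernel finitely generated; generators of the submodule of [B] are pulled
    back along [k]. *)
Lemma kernel_object B C (p : {linear B -> C}) :
  exists A (i : {linear A -> B}), injective i /\
    forall x, p x = 0 <-> exists y, i y = x.
Proof.
have sN : submodule (fun x => p x = 0).
  by split=> [|c x y px py]; rewrite ?linear0 // linearP px py scaler0 addr0.
have [K [k [inj kE]]] := submodule_object sN.
suff fgK : finitely_generated K by exists (FgMod fgK), k.
apply/finitely_generatedP; have [s sE] := noeth sN.
have [|t ts _] := @lift_seq _ K B k (fun=> True) s.
  by move=> y /span_mem/sE/kE[x <-]; exists x.
exists t => x; have /sE : p (k x) = 0 by apply/kE; exists x.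
by rewrite -ts => /span_map[y ty /inj <-].
Qed.

Lemma projective_presentation X :
  exists K P (k : {linear K -> P}) (p : {linear P -> X}),
    projective P /\ short_exact k p.
Proof.
have [P [p [pP ps]]] := projective_cover X.
by have [K [k [ki kE]]] := kernel_object p; exists K, P, k, p.
Qed.

(** [ext_vanishes 0] tests all sequences ending in [X]. One projective presentation is enough
    because [B] is the pushout of [K' <- K -> P], on which [u] and [v] glue. *)
Lemma ext1_vanishes_presentation X A K P
    (k : {linear K -> P}) (p : {linear P -> X}) :
    projective P -> short_exact k p ->
    (forall u : {linear K -> A},
       exists v : {linear P -> A}, forall x, v (k x) = u x) ->
  ext_vanishes 0 X A.
Proof.
move=> pP ses extP K' B k' q ses' u.
have [_ qs _] := ses'; have [_ ps pE] := ses.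
have [h hE] := pP _ _ q p qs.
have [|l lE] := lift_through_kernel ses' (f := h \o k).
  by move=> x /=; have /= -> := hE (k x); rewrite (short_exact0 ses).
have [v vE] := extP (u \o l).
pose e : {linear fg_prod K' P -> B} := (k' \o fst) \+ (h \o snd).
pose w : {linear fg_prod K' P -> A} := (u \o fst) \+ (v \o snd).
have [||z zE] := descend_along_epi (p := e) (f := w).
- move=> b; have [x xb] := ps (q b); have [_ _ q0] := ses'.
  have /q0[y yb] : q (b - h x) = 0.
    by rewrite linearB; have /= -> := hE x; rewrite xb subrr.
  by exists (y, x); rewrite /e /= yb subrK.
- move=> [y x]; rewrite /e /w /= => yx.
  have /pE[x' xx'] : p x = 0.
    have := hE x => /= <-; rewrite -[RHS](linear0 q) -yx linearD.
    by rewrite (short_exact0 ses') add0r.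
  subst x; rewrite vE /=.
  have [inj _ _] := ses'.
  have -> : y = - l x'.
    by apply: inj; rewrite linearN lE /=; apply/eqP; rewrite -addr_eq0 yx.
  by rewrite linearN addNr.
exists z => x.
have := zE (x, 0); rewrite /e /w /= !linear0 !addr0 //.
Qed.

(** The sequence of syzygies drives dimension shifting; the equation on [k (l x)] compares maps on
    [KA] with maps on [Q] in the lowest degree. *)
Lemma horseshoe A B C (i : {linear A -> B}) (p : {linear B -> C})
    KA Q KC P (a : {linear KA -> Q}) (q : {linear Q -> A})
    (c : {linear KC -> P}) (r : {linear P -> C}) :
    short_exact i p -> short_exact a q -> short_exact c r -> projective P ->
  exists KB (k : {linear KB -> fg_prod Q P}) (b : {linear fg_prod Q P -> B})
      (l : {linear KA -> KB}) (m : {linear KB -> KC}),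
    [/\ short_exact k b, short_exact l m & forall x, k (l x) = (a x, 0)].
Proof.
move=> [ii ps pE] [ai qs qE] [ci rs rE] pP.
have [h hE] := pP _ _ p r ps.
have {}hE x : p (h x) = r x by apply: hE.
pose b : {linear fg_prod Q P -> B} := (i \o q \o fst) \+ (h \o snd).
have pi x : p (i x) = 0 by apply/pE; exists x.
have bE x y : b (x, y) = i (q x) + h y by [].
have bs : surjective b.
  move=> y; have [x xy] := rs (p y).
  have /pE[z zE] : p (y - h x) = 0 by rewrite linearB hE xy subrr.
  by have [w wz] := qs z; exists (w, x); rewrite bE wz zE subrK.
have [KB [k [ki kE]]] := kernel_object b.
have bk x : b (k x) = 0 by apply/kE; exists x.
have [j jE] := linear_pair_l Q P.
have qa x : q (a x) = 0 by apply/qE; exists x.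
have [|l lE] := lift_through_mono (i := k) (f := j \o a) ki.
  by move=> x; apply/kE; rewrite -[b _]/(b (j (a x))) jE bE qa !linear0 addr0.
have [|m mE] := lift_through_mono (i := c) (f := snd \o k) ci.
  move=> x; apply/rE; rewrite /= -hE.
  have := congr1 p (bk x); case: (k x) => u v; rewrite bE linearD pi add0r /=.
  by move=> ->; rewrite linear0.
have {}lE x : k (l x) = (a x, 0) by rewrite lE /= jE.
have {}mE x : c (m x) = (k x).2 by rewrite mE.
exists KB, k, b, l, m; split=> //; split.
- by move=> x y e; have := lE x; rewrite e lE => -[/ai].
- move=> z; have /pE[w wE] : p (h (c z)) = 0 by rewrite hE; apply/rE; exists z.
  have [x xw] := qs w; have /kE[y ky] : b (- x, c z) = 0.
    by rewrite bE !linearN xw wE addNr.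
  by exists y; apply: ci; rewrite mE ky.
- move=> y; split=> [my|[x <-]]; last first.
    by apply: ci; rewrite mE lE linear0.
  have := bk y; have := mE y; rewrite my linear0.
  case ky: (k y) => [u v]; rewrite bE /= => v0.
  rewrite -v0 (linear0 h) addr0 => iu.
  have /qE[x xu] : q u = 0 by apply: ii; rewrite iu (linear0 i).
  by exists x; apply: ki; rewrite lE ky xu -v0.
Qed.

(** * Exactness of the long Ext sequences in either variable *)

Section LongExact.
Variables (A B C : fgmod R) (i : {linear A -> B}) (p : {linear B -> C}).
Hypothesis ses : short_exact i p.

(** Exactness of Hom(B, X) -> Hom(A, X) -> Ext^1(C, X) -> Ext^1(B, X). The pullback [E] of [q] and
    [p] is an extension of [B], so [u] extends to [E]; subtracting a map that factors through [B]
    makes it vanish on [A] and descend to [D]. *)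
Lemma ext1_vanishes_cokernel X : ext_vanishes 0 B X ->
  (forall u : {linear A -> X},
     exists v : {linear B -> X}, forall x, v (i x) = u x) ->
  ext_vanishes 0 C X.
Proof.
have [ii ps pE] := ses.
move=> eB eA K D k q [ki qs qE] u.
pose f : {linear fg_prod D B -> C} := (q \o fst) \- (p \o snd).
have [E [e [ei eE]]] := kernel_object f.
have feq x : q (e x).1 = p (e x).2.
  by apply/eqP; rewrite -subr_eq0; apply/eqP; apply/eE; exists x.
have qk x : q (k x) = 0 by apply/qE; exists x.
have pi x : p (i x) = 0 by apply/pE; exists x.
have [j1 j1E] := linear_pair_l D B; have [j2 j2E] := linear_pair_r D B.
have [|l1 l1E] := lift_through_mono (i := e) (f := j1 \o k) ei.
  by move=> x; apply/eE; rewrite /= j1E /f /= qk linear0 subr0.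
have [|l2 l2E] := lift_through_mono (i := e) (f := j2 \o i) ei.
  by move=> x; apply/eE; rewrite /= j2E /f /= pi linear0 subr0.
have {}l1E x : e (l1 x) = (k x, 0) by rewrite l1E /= j1E.
have {}l2E x : e (l2 x) = (0, i x) by rewrite l2E /= j2E.
have ses1 : short_exact l1 (snd \o e : {linear E -> B}).
  split=> [x y /(congr1 e)|y|x].
  - by rewrite !l1E => -[/ki].
  - have [d dy] := qs (p y).
    have /eE[x xE] : f (d, y) = 0 by rewrite /f /= dy subrr.
    by exists x; rewrite /= xE.
  - split=> [/= ex|[y <-]]; last by rewrite /= l1E.
    have := feq x; rewrite ex linear0 => /qE[y yx].
    by exists y; apply: ei; rewrite l1E yx -ex; case: (e x).
have [v vE] := eB _ _ _ _ ses1 u.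
have [w wE] := eA (v \o l2).
have [||g gE] := descend_along_epi (p := (fst \o e : {linear E -> D}))
    (f := v \- (w \o (snd \o e))).
- move=> d; have [b bd] := ps (q d).
  have /eE[x xE] : f (d, b) = 0 by rewrite /f /= bd subrr.
  by exists x; rewrite /= xE.
- move=> x /= ex; have := feq x; rewrite ex linear0 => /esym/pE[y yx].
  have -> : x = l2 y by apply: ei; rewrite l2E yx -ex; case: (e x).
  by rewrite l2E /= wE subrr.
exists g => x.
by have /= := gE (l1 x); rewrite l1E /= linear0 subr0 vE.
Qed.

End LongExact.

(** Exactness of Ext^(j+1)(A, X) -> Ext^(j+2)(C, X) -> Ext^(j+2)(B, X). The horseshoe replaces the
    sequence by its syzygies, lowering degrees until [ext1_vanishes_cokernel] applies. *)
Lemma ext_vanishes_cokernel j A B C (i : {linear A -> B}) (p : {linear B -> C})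
    X : short_exact i p ->
  ext_vanishes j A X -> ext_vanishes j.+1 B X -> ext_vanishes j.+1 C X.
Proof.
elim: j A B C i p => [|j IH] A B C i p ses eA eB KC P c r pP sesC.
  have [KA [Q [a [q [pQ sesA]]]]] := projective_presentation A.
  have [KB [k [b [l [m [sesB sesK klE]]]]]] := horseshoe ses sesA sesC pP.
  apply: (ext1_vanishes_cokernel sesK).
    exact: eB (projective_prod pQ pP) sesB.
  move=> u; have [v vE] := eA _ _ _ _ sesA u.
  by exists (v \o (fst \o k)) => x; rewrite /= klE vE.
have [KA [Q [a [q [pQ sesA]]]]] := projective_presentation A.
have [KB [k [b [l [m [sesB sesK _]]]]]] := horseshoe ses sesA sesC pP.
apply: IH sesK _ _; first exact: eA pQ sesA.
exact: eB (projective_prod pQ pP) sesB.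
Qed.

Lemma ext_vanishes_kernel j A B C (i : {linear A -> B}) (p : {linear B -> C})
    X : short_exact i p ->
  ext_vanishes j B X -> ext_vanishes j.+1 C X -> ext_vanishes j A X.
Proof.
elim: j A B C i p => [|j IH] A B C i p ses eB eC; last first.
  move=> KA Q a q pQ sesA.
  have [KC [P [c [r [pP sesC]]]]] := projective_presentation C.
  have [KB [k [b [l [m [sesB sesK _]]]]]] := horseshoe ses sesA sesC pP.
  apply: IH sesK _ _; last exact: eC pP sesC.
  exact: eB (projective_prod pQ pP) sesB.
have [KA [Q [a [q [pQ sesA]]]]] := projective_presentation A.
have [KC [P [c [r [pP sesC]]]]] := projective_presentation C.
have [KB [k [b [l [m [sesB sesK klE]]]]]] := horseshoe ses sesA sesC pP.
apply: (ext1_vanishes_presentation pQ sesA) => u.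
have [v vE] := eC _ _ _ _ pP sesC _ _ _ _ sesK u.
have [w wE] := eB _ _ _ _ sesB v.
have [j1 j1E] := linear_pair_l Q P.
by exists (w \o j1) => x; rewrite /= j1E -klE wE vE.
Qed.

(** Lifted to the projective [P], the map sends the syzygy into [A]; extending that restriction to
    [P] gives the correction after which the lift descends to [X]. *)
Lemma lift_of_ext1_vanishes A B C (i : {linear A -> B}) (p : {linear B -> C})
    X (f : {linear X -> C}) : short_exact i p ->
  ext_vanishes 0 X A -> exists g : {linear X -> B}, forall x, p (g x) = f x.
Proof.
move=> ses eX; have [ii ps pE] := ses.
have [K [P [k [q [pP sesX]]]]] := projective_presentation X.
have [v vE] := pP _ _ p (f \o q) ps.
have {}vE x : p (v x) = f (q x) by apply: vE.
have [|w wE] := lift_through_kernel ses (f := v \o k).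
  by move=> x; rewrite /= vE (short_exact0 sesX) linear0.
have [w' w'E] := eX _ _ _ _ sesX w.
have [|g gE] := descend_to_cokernel sesX (f := v \- (i \o w')).
  by move=> x; rewrite /= w'E wE subrr.
exists g => x; have [_ qs _] := sesX; have [y <-] := qs x.
by rewrite gE /= linearB vE (short_exact0 ses) subr0.
Qed.

(** Extend [u] with values in [B]; the induced map from [X] to [C] lifts to [B], and subtracting the
    lift brings the extension back into [A]. *)
Lemma ext1_vanishes_lift A B C (i : {linear A -> B}) (p : {linear B -> C})
    X : short_exact i p -> ext_vanishes 0 X B ->
  (forall f : {linear X -> C},
     exists g : {linear X -> B}, forall x, p (g x) = f x) ->
  ext_vanishes 0 X A.
Proof.
move=> ses eB liftX K E k q sesX u; have [ii _ _] := ses.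
have [v vE] := eB _ _ _ _ sesX (i \o u).
have {}vE x : v (k x) = i (u x) by apply: vE.
have [|w wE] := descend_to_cokernel sesX (f := p \o v).
  by move=> x; rewrite /= vE (short_exact0 ses).
have [w' w'E] := liftX w.
have [|g gE] := lift_through_kernel ses (f := v \- (w' \o q)).
  by move=> x; rewrite /= linearB w'E wE subrr.
exists g => x; apply: ii.
by rewrite gE /= (short_exact0 sesX) linear0 subr0 vE.
Qed.

(** In the second variable the sequence stays fixed and [X] is replaced by its syzygies, down to
    Ext^1(X, B) -> Ext^1(X, C) -> Ext^2(X, A). *)
Lemma ext_vanishes_quotient j A B C (i : {linear A -> B}) (p : {linear B -> C})
    X : short_exact i p ->
  ext_vanishes j X B -> ext_vanishes j.+1 X A -> ext_vanishes j X C.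
Proof.
move=> ses; elim: j X => [|j IH] X eB eA; last first.
  move=> K P k q pP sesX; apply: IH; first exact: eB pP sesX.
  exact: eA pP sesX.
have [K [P [k [q [pP sesX]]]]] := projective_presentation X.
apply: (ext1_vanishes_presentation pP sesX) => u.
have [v vE] := lift_of_ext1_vanishes u ses (eA _ _ _ _ pP sesX).
have [w wE] := eB _ _ _ _ sesX v.
by exists (p \o w) => x; rewrite /= wE vE.
Qed.

Lemma ext_vanishes_sub j A B C (i : {linear A -> B}) (p : {linear B -> C})
    X : short_exact i p ->
  ext_vanishes j X C -> ext_vanishes j.+1 X B -> ext_vanishes j.+1 X A.
Proof.
move=> ses; elim: j X => [|j IH] X eC eB K P k q pP sesX; last first.
  apply: IH; first exact: eC pP sesX.
  exact: eB pP sesX.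
apply: (ext1_vanishes_lift ses); first exact: eB pP sesX.
move=> f; have [g gE] := eC _ _ _ _ sesX f; have [_ ps _] := ses.
have [h hE] := pP _ _ p g ps.
by exists (h \o k) => x /=; have /= -> := hE (k x).
Qed.

(** * Comparison with Ext computed from projective resolutions *)

Section ShiftResolution.
Variables (X K : fgmod R) (P : proj_resolution X).
Variables (k : {linear K -> pr_mod P 0}) (e : {linear pr_mod P 1 -> K}).
Hypotheses (ses : short_exact k (pr_aug P))
  (ke : forall x, k (e x) = pr_d P 0 x).

Lemma shift_aug_surj : surjective e.
Proof.
have [ki _ kE] := ses => y.
have /pr_exact0[x xy] : pr_aug P (k y) = 0 by apply/kE; exists y.
by exists x; apply: ki; rewrite ke.
Qed.

Lemma shift_exact0 x : e x = 0 <-> exists y, pr_d P 1 y = x.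
Proof.
rewrite -pr_exactS -ke; split=> [->|kex]; first by rewrite linear0.
by have [ki _ _] := ses; apply: ki; rewrite kex (linear0 k).
Qed.

Definition shift_resolution : proj_resolution K :=
  @ProjResolution R K (fun i => pr_mod P i.+1) (fun i => pr_d P i.+1) e
    (fun i => @pr_proj _ _ P i.+1) shift_aug_surj shift_exact0
    (fun i => @pr_exactS _ _ P i.+1).
End ShiftResolution.

Section ConsResolution.
Variables (X K P : fgmod R) (k : {linear K -> P}) (p : {linear P -> X}).
Hypotheses (pP : projective P) (ses : short_exact k p).
Variable Q : proj_resolution K.

Let m i := if i is j.+1 then pr_mod Q j else P.
Let d i : {linear m i.+1 -> m i} :=
  match i return {linear m i.+1 -> m i} with
  | 0 => (k \o pr_aug Q : {linear m 1 -> m 0})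
  | j.+1 => pr_d Q j
  end.

Fact cons_proj i : projective (m i).
Proof. by case: i => //= i; apply: pr_proj. Qed.

Fact cons_surj : surjective p.
Proof. by case: ses. Qed.

Fact cons_exact0 x : p x = 0 <-> exists y, d 0 y = x.
Proof.
have [_ _ pE] := ses; rewrite pE; split=> [[y <-]|[y <-]].
  by have [z <-] := pr_aug_surj Q y; exists z.
by exists (pr_aug Q y).
Qed.

Fact cons_exactS i x : d i x = 0 <-> exists y, d i.+1 y = x.
Proof.
case: i x => [|i] x; last exact: pr_exactS.
rewrite -[X in _ <-> X]pr_exact0 /=; split=> [e|->]; last exact: linear0.
by have [ki _ _] := ses; apply: ki; rewrite e (linear0 k).
Qed.

Definition cons_resolution : proj_resolution X :=
  @ProjResolution R X m d p cons_proj cons_surj cons_exact0 cons_exactS.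
End ConsResolution.

Record presentation X := Presentation {
  ps_ker : fgmod R; ps_cover : fgmod R;
  ps_inj : {linear ps_ker -> ps_cover};
  ps_map : {linear ps_cover -> X};
  ps_proj : projective ps_cover;
  ps_ses : short_exact ps_inj ps_map }.

Lemma resolution_exists X : inhabited (proj_resolution X).
Proof.
have ex Y : exists p : presentation Y, True.
  have [K [P [k [p [pP ses]]]]] := projective_presentation Y.
  by exists (Presentation pP ses).
pose pr Y := projT1 (cid (ex Y)).
pose Om i := iter i (fun Y => ps_ker (pr Y)) X.
pose m i := ps_cover (pr (Om i)).
pose d i : {linear m i.+1 -> m i} :=
  ps_inj (pr (Om i)) \o ps_map (pr (Om i.+1)).
have surj Y : surjective (ps_map (pr Y)) by case: (ps_ses (pr Y)).
have inj Y : injective (ps_inj (pr Y)) by case: (ps_ses (pr Y)).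
have exact Y x : ps_map (pr Y) x = 0 <-> exists y, ps_inj (pr Y) y = x.
  by case: (ps_ses (pr Y)).
split; apply: (@ProjResolution R X m d (ps_map (pr X))).
- by move=> i; apply: ps_proj.
- exact: surj.
- move=> x; rewrite exact; split=> [[y <-]|[y <-]].
    by have [z <-] := surj (Om 1) y; exists z.
  by exists (ps_map (pr (Om 1)) y).
- move=> i x; have -> : d i x = 0 <-> ps_map (pr (Om i.+1)) x = 0.
    split=> [dx|px]; last by rewrite /d /= px linear0.
    by apply: (inj (Om i)); rewrite (linear0 (ps_inj _)).
  rewrite exact; split=> [[y <-]|[y <-]].
    by have [z <-] := surj (Om i.+2) y; exists z.
  by exists (ps_map (pr (Om i.+2)) y).
Qed.

(** In degree one, a cocycle is a map on the syzygy and a coboundary is one that extends to the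
    first projective. In the inductive step, resolutions are prolonged by the given presentation in
    one direction and truncated in the other. *)
Lemma Ext_eq0_vanishes i X A : Ext_eq0 i.+1 X A <-> ext_vanishes i X A.
Proof.
elim: i X => [|i IH] X; split.
- move=> E; have [P] := resolution_exists X.
  have [K [k [ki kE]]] := kernel_object (pr_aug P).
  have ses : short_exact k (pr_aug P) by split=> //; apply: pr_aug_surj.
  have [|e ke] := lift_through_kernel ses (f := pr_d P 0).
    by move=> x; apply/pr_exact0; exists x.
  apply: (ext1_vanishes_presentation (@pr_proj _ _ P 0) ses) => u.
  have [|v vE] := E P (u \o e).
    move=> x /=; have -> : e (pr_d P 1 x) = 0.
      by apply/(shift_exact0 ses ke); exists x.
    exact: linear0.
  exists v => x; have [y <-] := shift_aug_surj ses ke x.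
  by rewrite ke; have /= <- := vE y.
- move=> E P f cf.
  have [K [k [ki kE]]] := kernel_object (pr_aug P).
  have ses : short_exact k (pr_aug P) by split=> //; apply: pr_aug_surj.
  have [|e ke] := lift_through_kernel ses (f := pr_d P 0).
    by move=> x; apply/pr_exact0; exists x.
  have [|g gE] := descend_along_epi (f := f) (shift_aug_surj ses ke).
    by move=> x /(shift_exact0 ses ke)[y <-].
  have [v vE] := E _ _ _ _ ses g.
  by exists v => x; rewrite /= -ke vE gE.
- move=> E K P k p pP ses; apply/IH => Q f cf.
  exact: (E (cons_resolution pP ses Q)).
- move=> E P f cf.
  have [K [k [ki kE]]] := kernel_object (pr_aug P).
  have ses : short_exact k (pr_aug P) by split=> //; apply: pr_aug_surj.
  have [|e ke] := lift_through_kernel ses (f := pr_d P 0).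
    by move=> x; apply/pr_exact0; exists x.
  have /IH EK := E _ _ _ _ (@pr_proj _ _ P 0) ses.
  exact: (EK (shift_resolution ses ke)).
Qed.

End Noetherian.
End FgModules.

(** * Equivalences of preadditive categories *)

Local Open Scope cat_scope.

Definition fully_faithful_dense (C D : preadd) (F : functor C D) :=
  [/\ forall x y (f g : hom x y), fmap F f =h fmap F g -> f =h g,
      forall x y (h : hom (F x) (F y)), exists f, fmap F f =h h
    & forall d, exists x, iso (F x) d].

(** This form composes easily along the chain; a quasi-inverse is built once, at the end. *)
Definition ff_equivalent (C D : preadd) :=
  exists F : functor C D, fully_faithful_dense F.

Lemma iso_refl (C : preadd) (x : C) : iso x x.
Proof. by exists (idm x), (idm x); rewrite comp1f. Qed.

Lemma iso_trans (C : preadd) (x y z : C) : iso x y -> iso y z -> iso x z.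
Proof.
move=> [f [g [gf fg]]] [h [k [kh hk]]]; exists (h \oc f), (g \oc k); split.
  by rewrite -compA (compA k) kh comp1f.
by rewrite -compA (compA f) fg comp1f.
Qed.

Lemma iso_fmap (C D : preadd) (F : functor C D) (x y : C) :
  iso x y -> iso (F x) (F y).
Proof.
move=> [f [g [gf fg]]]; exists (fmap F f), (fmap F g).
by rewrite -!fmap_comp (fmap_proper F gf) (fmap_proper F fg) !fmap1.
Qed.

Lemma ff_equivalent_refl (C : preadd) : ff_equivalent C C.
Proof.
exists (functor_id C); split=> [//|x y h|d]; first by exists h.
by exists d; apply: iso_refl.
Qed.

Lemma ff_equivalent_trans (C D E : preadd) :
  ff_equivalent C D -> ff_equivalent D E -> ff_equivalent C E.
Proof.
move=> [F [Fi Fs Fd]] [G [Gi Gs Gd]]; exists (functor_comp G F); split.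
- by move=> x y f g /Gi/Fi.
- move=> x y h; have [k kE] := Gs _ _ h; have [f fE] := Fs _ _ k.
  by exists f; rewrite -kE; apply: (fmap_proper G fE).
- move=> e; have [d de] := Gd e; have [x xd] := Fd d.
  by exists x; apply: iso_trans de; apply: (iso_fmap G xd).
Qed.

Lemma ff_equivalent_equivalent (C D : additive_cat) :
  ff_equivalent C D -> equivalent C D.
Proof.
move=> [F [Fi Fs Fd]].
have [o oE] := choice Fd.
have [i iE] : exists i : (forall d, hom (F (o d)) d),
    forall d, exists j, j \oc i d =h idm _ /\ i d \oc j =h idm _.
  by exists (fun d => projT1 (cid (oE d))) => d; apply: projT2 (cid (oE d)).
have [j jE] : exists j : (forall d, hom d (F (o d))),
    forall d, j d \oc i d =h idm _ /\ i d \oc j d =h idm _.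
  by exists (fun d => projT1 (cid (iE d))) => d; apply: projT2 (cid (iE d)).
have ji d : j d \oc i d =h idm _ by case: (jE d).
have ij d : i d \oc j d =h idm _ by case: (jE d).
pose pre x y (h : hom (F x) (F y)) := projT1 (cid (Fs x y h)).
have preE x y h : fmap F (@pre x y h) =h h by apply: projT2 (cid (Fs x y h)).
pose Gm x y (h : hom x y) := pre _ _ (j y \oc h \oc i x).
have GP x y f g : f =h g -> Gm x y f =h Gm x y g.
  by move=> e; apply: Fi; rewrite !preE e.
have G1 x : Gm x x (idm x) =h idm _.
  by apply: Fi; rewrite preE compf1 ji fmap1.
have GC x y z (g : hom y z) (f : hom x y) :
    Gm x z (g \oc f) =h Gm y z g \oc Gm x y f.
  apply: Fi; rewrite fmap_comp !preE -!compA (compA (i y)) ij comp1f.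
  by [].
have GD x y (f g : hom x y) : Gm x y (f +h g) =h Gm x y f +h Gm x y g.
  by apply: Fi; rewrite fmapD !preE compDr compDl.
pose G : functor D C := Functor GP G1 GC GD.
exists F, G; split.
- have a1 x y (f : hom x y) :
      f \oc pre (o (F x)) x (i (F x)) =h
      pre (o (F y)) y (i (F y)) \oc Gm (F x) (F y) (fmap F f).
    apply: Fi; rewrite !fmap_comp !preE !compA ij comp1f.
    by [].
  have a2 x y (f : hom x y) :
      Gm (F x) (F y) (fmap F f) \oc pre x (o (F x)) (j (F x)) =h
      pre y (o (F y)) (j (F y)) \oc f.
    apply: Fi; rewrite !fmap_comp !preE -!compA ij compf1.
    by [].
  exists (@NatTrans _ _ (functor_comp G F) (functor_id C)
            (fun x => pre _ _ (i (F x))) a1).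
  exists (@NatTrans _ _ (functor_id C) (functor_comp G F)
            (fun x => pre _ _ (j (F x))) a2).
  by split=> x /=; apply: Fi; rewrite fmap_comp !preE fmap1.
- have b1 x y (h : hom x y) : h \oc i x =h i y \oc fmap F (Gm x y h).
    by rewrite preE !compA ij comp1f.
  have b2 x y (h : hom x y) : fmap F (Gm x y h) \oc j x =h j y \oc h.
    by rewrite preE -!compA ij compf1.
  exists (@NatTrans _ _ (functor_comp F G) (functor_id D) i b1).
  exists (@NatTrans _ _ (functor_id D) (functor_comp F G) j b2).
  by split=> x /=.
Qed.

(** * Equivalences from correspondences *)

Section Span.
Variables (C D : preadd) (T : Type) (c : T -> C) (d : T -> D).
Variable rel : forall t u, hom (c t) (c u) -> hom (d t) (d u) -> Prop.
Hypotheses (c_dense : forall x, exists t, iso (c t) x)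
  (d_dense : forall y, exists t, iso (d t) y)
  (rel_left : forall t u (f : hom (c t) (c u)),
     exists g : hom (d t) (d u), rel f g)
  (rel_right : forall t u (g : hom (d t) (d u)),
     exists f : hom (c t) (c u), rel f g)
  (rel1 : forall t, rel (idm (c t)) (idm (d t)))
  (rel_comp : forall t u v f g f' g', @rel t u f g -> @rel u v f' g' ->
     rel (f' \oc f) (g' \oc g))
  (relD : forall t u f g f' g', @rel t u f g -> @rel t u f' g' ->
     rel (f +h f') (g +h g'))
  (relN : forall t u f g, @rel t u f g -> rel (hopp f) (hopp g))
  (rel0 : forall t u f g, @rel t u f g ->
     (f =h hzero (c t) (c u) <-> g =h hzero (d t) (d u))).

Let hsub_eq0 (E : preadd) (x y : E) (f g : hom x y) :
  f +h hopp g =h hzero x y <-> f =h g.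
Proof.
split=> [e|->]; last exact: haddfN.
by rewrite -(haddf0 f) -(haddNf g) haddA e hadd0f.
Qed.

Lemma rel_eq t u f g f' g' : @rel t u f g -> @rel t u f' g' ->
  (f =h f' <-> g =h g').
Proof.
move=> r r'; have r0 := rel0 (relD r (relN r')).
by split=> e; apply/hsub_eq0/r0/hsub_eq0.
Qed.

(* A correspondence that is total and bijective on morphisms determines the
   functor after a choice of related objects. *)
Lemma span_ff_equivalent : ff_equivalent C D.
Proof.
have [o oE] := choice c_dense.
have [i iE] : exists i : (forall x, hom (c (o x)) x),
    forall x, exists j, j \oc i x =h idm _ /\ i x \oc j =h idm _.
  by exists (fun x => projT1 (cid (oE x))) => x; apply: projT2 (cid (oE x)).
have [j jE] : exists j : (forall x, hom x (c (o x))),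
    forall x, j x \oc i x =h idm _ /\ i x \oc j x =h idm _.
  by exists (fun x => projT1 (cid (iE x))) => x; apply: projT2 (cid (iE x)).
have ji x : j x \oc i x =h idm _ by case: (jE x).
have ij x : i x \oc j x =h idm _ by case: (jE x).
pose G t u (f : hom (c t) (c u)) := projT1 (cid (rel_left f)).
have GE t u f : rel f (G t u f) by apply: projT2 (cid (rel_left f)).
have Geq u v f g : rel f g -> G u v f =h g.
  by move=> r; apply/(rel_eq (GE u v f) r).
(* Conjugation moves [f] to the chosen objects [c (o x)] and [c (o y)], where [rel] applies. *)
pose cf x y (f : hom x y) := j y \oc f \oc i x.
pose Fm x y (f : hom x y) := G _ _ (cf x y f).
have FP x y f g : f =h g -> Fm x y f =h Fm x y g.
  by move=> e; apply/(rel_eq (GE _ _ _) (GE _ _ _)); rewrite /cf e.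
have F1 x : Fm x x (idm x) =h idm (d (o x)).
  by apply/(rel_eq (GE _ _ _) (rel1 _)); rewrite /cf compf1 ji.
have FC x y z (g : hom y z) (f : hom x y) :
    Fm x z (g \oc f) =h Fm y z g \oc Fm x y f.
  apply/(rel_eq (GE _ _ _) (rel_comp (GE _ _ _) (GE _ _ _))).
  by rewrite /cf -!compA (compA (i y)) ij comp1f.
have FD x y (f g : hom x y) : Fm x y (f +h g) =h Fm x y f +h Fm x y g.
  apply/(rel_eq (GE _ _ _) (relD (GE _ _ _) (GE _ _ _))).
  by rewrite /cf compDr compDl.
exists (Functor FP F1 FC FD); split=> /=.
- move=> x y f g /(rel_eq (GE _ _ _) (GE _ _ _)).
  move=> e; have cfK h : h =h i y \oc cf x y h \oc j x.
    by rewrite /cf -!compA ij compf1 compA ij comp1f.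
  by rewrite (cfK f) (cfK g) e.
- move=> x y h; have [f fh] := rel_right h.
  exists (i y \oc f \oc j x); apply/(rel_eq (GE _ _ _) fh).
  by rewrite /cf -!compA ji compf1 compA ji comp1f.
(* The functor sends [c u] to [d (o (c u))], and [o (c u)] may differ from [u]; the isomorphism
   between their images under [c] is carried over by [rel]. *)
- move=> e; have [u ue] := d_dense e; exists (c u); apply: iso_trans ue.
  have [f [g [gf fg]]] := oE (c u).
  have [f' ff'] := rel_left f; have [g' gg'] := rel_left g.
  exists f', g'; split.
    by apply/(rel_eq (rel_comp ff' gg') (rel1 _)).
  by apply/(rel_eq (rel_comp gg' ff') (rel1 _)).
Qed.
End Span.

(** * Short exact sequences up to homotopy *)

Section SesCategory.
Variables (R : pzRingType) (M : fgmod R -> Prop).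

Record ses (l r : fgmod R -> Prop) := Ses {
  ses_a : fgmod R; ses_b : fgmod R; ses_c : fgmod R;
  ses_i : {linear ses_a -> ses_b};
  ses_p : {linear ses_b -> ses_c};
  sesP : short_exact ses_i ses_p;
  ses_left : l ses_a; ses_mid : M ses_b; ses_right : r ses_c }.

Variables l r : fgmod R -> Prop.
Implicit Types x y z : ses l r.

Record ses_hom x y := SesHom {
  hom_a : {linear ses_a x -> ses_a y};
  hom_b : {linear ses_b x -> ses_b y};
  hom_c : {linear ses_c x -> ses_c y};
  hom_ab : forall u, ses_i y (hom_a u) = hom_b (ses_i x u);
  hom_bc : forall u, ses_p y (hom_b u) = hom_c (ses_p x u) }.

Definition ses_zero x y : ses_hom x y.
Proof.
by exists \0 \0 \0 => u /=; rewrite linear0.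
Defined.

Definition ses_opp x y (f : ses_hom x y) : ses_hom x y.
Proof.
exists (\- hom_a f) (\- hom_b f) (\- hom_c f) => u /=.
  by rewrite linearN hom_ab.
by rewrite linearN hom_bc.
Defined.

Definition ses_add x y (f g : ses_hom x y) : ses_hom x y.
Proof.
exists (hom_a f \+ hom_a g) (hom_b f \+ hom_b g) (hom_c f \+ hom_c g) => u /=.
  by rewrite linearD !hom_ab.
by rewrite linearD !hom_bc.
Defined.

Definition ses_id x : ses_hom x x.
Proof. by exists idfun idfun idfun. Defined.

Definition ses_comp x y z (g : ses_hom y z) (f : ses_hom x y) : ses_hom x z.
Proof.
exists (hom_a g \o hom_a f) (hom_b g \o hom_b f) (hom_c g \o hom_c f) => u /=.
  by rewrite !hom_ab.
by rewrite !hom_bc.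
Defined.

(* Morphisms are taken up to homotopy; by [ses_nullP] below the two possible
   homotopies, on the left and on the right, give the same relation. *)
Definition ses_null x y (f : {linear ses_c x -> ses_c y}) :=
  exists h : {linear ses_c x -> ses_b y}, forall u, f u = ses_p y (h u).

Definition ses_heq x y (f g : ses_hom x y) :=
  ses_null (hom_c f \- hom_c g : {linear _ -> _}).

Lemma ses_null0 x y (f : {linear ses_c x -> ses_c y}) :
  (forall u, f u = 0) -> ses_null f.
Proof. by move=> f0; exists \0 => u; rewrite f0 /= linear0. Qed.

Lemma ses_nullD x y (f g h : {linear ses_c x -> ses_c y}) :
  ses_null f -> ses_null g -> (forall u, h u = f u + g u) -> ses_null h.
Proof.
move=> [a aE] [b bE] hE; exists (a \+ b) => u /=.
by rewrite linearD hE aE bE.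
Qed.

Lemma ses_nullN x y (f h : {linear ses_c x -> ses_c y}) :
  ses_null f -> (forall u, h u = - f u) -> ses_null h.
Proof.
by move=> [a aE] hE; exists (\- a) => u /=; rewrite linearN hE aE.
Qed.

Lemma ses_null_compr x y z (f : {linear ses_c x -> ses_c y})
    (g : {linear ses_c y -> ses_c z}) : ses_null g -> ses_null (g \o f).
Proof. by move=> [a aE]; exists (a \o f) => u /=; rewrite aE. Qed.

Lemma ses_null_compl x y z (f : {linear ses_c x -> ses_c y}) (g : ses_hom y z) :
  ses_null f -> ses_null (hom_c g \o f).
Proof.
by move=> [a aE]; exists (hom_b g \o a) => u /=; rewrite aE hom_bc.
Qed.

Lemma ses_heqW x y (f g : ses_hom x y) : hom_c f =1 hom_c g -> ses_heq f g.
Proof. by move=> e; apply: ses_null0 => u /=; rewrite e subrr. Qed.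

Lemma ses_heq0 x y (f : ses_hom x y) :
  ses_heq f (ses_zero x y) <-> ses_null (hom_c f).
Proof. by split=> -[h hE]; exists h => u; rewrite -hE /= subr0. Qed.

(** Given a homotopy on one side, subtract from [hom_b f] the map it induces on middle terms; the
    difference factors through the kernel of the target, or the cokernel of the source, which is the
    other homotopy. *)
Lemma ses_nullP x y (f : ses_hom x y) :
  ses_null (hom_c f) <->
  exists h : {linear ses_b x -> ses_a y}, forall u, hom_a f u = h (ses_i x u).
Proof.
have [iy _ _] := sesP y; split=> -[h hE].
  have [|k kE] := lift_through_kernel (sesP y) (f := hom_b f \- (h \o ses_p x)).
    by move=> u /=; rewrite linearB hom_bc -hE subrr.
  exists k => u; apply: iy.
  by rewrite kE /= (short_exact0 (sesP x)) linear0 subr0 hom_ab.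
have [|k kE] := descend_to_cokernel (sesP x) (f := hom_b f \- (ses_i y \o h)).
  by move=> u /=; rewrite -hE hom_ab subrr.
exists k => u; have [_ ps _] := sesP x; have [v <-] := ps u.
by rewrite kE /= linearB (short_exact0 (sesP y)) subr0 hom_bc.
Qed.

Definition ses_cat : preadd.
Proof.
refine (@Preadd (ses l r) ses_hom ses_heq ses_zero ses_opp ses_add ses_id
  ses_comp _ _ _ _ _ _ _ _ _ _ _ _ _).
- move=> x y; split=> [f|f g fg|f g h fg gh]; first exact: ses_heqW.
    by apply: ses_nullN fg _ => u /=; rewrite opprB.
  by apply: ses_nullD fg gh _ => u /=; rewrite addrA subrK.
- move=> x y f g fg; apply: ses_nullN fg _ => u /=.
  by rewrite opprB opprK addrC.
- move=> x y f f' g g' e e'; apply: ses_nullD e e' _ => u /=.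
  by rewrite opprD addrACA.
- move=> x y z g g' f f' eg ef.
  apply: ses_nullD (ses_null_compr (hom_c f) eg) (ses_null_compl g' ef) _.
  by move=> u /=; rewrite linearB addrA subrK.
- by move=> x y f g h; apply: ses_heqW => u /=; rewrite addrA.
- by move=> x y f g; apply: ses_heqW => u /=; rewrite addrC.
- by move=> x y f; apply: ses_heqW => u /=; rewrite add0r.
- by move=> x y f; apply: ses_heqW => u /=; rewrite addNr.
- by move=> x y z t h g f; apply: ses_heqW.
- by move=> x y f; apply: ses_heqW.
- by move=> x y f; apply: ses_heqW.
- by move=> x y z g g' f; apply: ses_heqW.
- by move=> x y z g f f'; apply: ses_heqW => u /=; rewrite linearD.
Defined.

End SesCategory.

(** * One step of the chain *)

Section Step.
Variables (R : pzRingType) (M l r l' r' : fgmod R -> Prop).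
Hypotheses
  (lift_mid : forall (A B C X : fgmod R)
     (i : {linear A -> B}) (p : {linear B -> C})
     (f : {linear X -> C}), short_exact i p -> l A -> M X ->
     exists g : {linear X -> B}, forall x, p (g x) = f x)
  (extend_mid : forall (A B C X : fgmod R)
     (i : {linear A -> B}) (p : {linear B -> C})
     (f : {linear A -> X}), short_exact i p -> r' C -> M X ->
     exists g : {linear B -> X}, forall x, g (i x) = f x)
  (next_ses : forall x : ses M l r,
     exists (B C : fgmod R) (i : {linear ses_c x -> B}) (p : {linear B -> C}),
     [/\ short_exact i p, l' (ses_c x), M B & r' C])
  (prev_ses : forall x : ses M l' r',
     exists (A B : fgmod R) (i : {linear A -> B}) (p : {linear B -> ses_a x}),
     [/\ short_exact i p, l A, M B & r (ses_a x)]).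

(** An exact sequence 0 -> a -> b -> c -> d -> e -> 0 cut at [gl_c], so that both halves are given
    together. *)
Record glued := Glued {
  gl_a : fgmod R; gl_b : fgmod R; gl_c : fgmod R;
  gl_d : fgmod R; gl_e : fgmod R;
  gl_i : {linear gl_a -> gl_b}; gl_p : {linear gl_b -> gl_c};
  gl_j : {linear gl_c -> gl_d}; gl_q : {linear gl_d -> gl_e};
  gl_ses1 : short_exact gl_i gl_p; gl_ses2 : short_exact gl_j gl_q;
  gl_left1 : l gl_a; gl_mid1 : M gl_b; gl_right1 : r gl_c;
  gl_left2 : l' gl_c; gl_mid2 : M gl_d; gl_right2 : r' gl_e }.

Definition glued_fst (t : glued) : ses_cat M l r :=
  Ses (gl_ses1 t) (gl_left1 t) (gl_mid1 t) (gl_right1 t).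
Definition glued_snd (t : glued) : ses_cat M l' r' :=
  Ses (gl_ses2 t) (gl_left2 t) (gl_mid2 t) (gl_right2 t).

Definition glued_rel t u (f : hom (glued_fst t) (glued_fst u))
    (g : hom (glued_snd t) (glued_snd u)) :=
  hom_c f =1 hom_a g.

Lemma ses_cat_step : ff_equivalent (ses_cat M l r) (ses_cat M l' r').
Proof.
apply: (span_ff_equivalent (c := glued_fst) (d := glued_snd)
  (rel := glued_rel)).
- case=> A B C i p s lA MB rC.
  have [D [E [j [q [s' lC MD rE]]]]] := next_ses (Ses s lA MB rC).
  exists (Glued s s' lA MB rC lC MD rE), (ses_id _), (ses_id _).
  by split; apply: ses_heqW.
- case=> C D E j q s' lC MD rE.
  have [A [B [i [p [s lA MB rC]]]]] := prev_ses (Ses s' lC MD rE).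
  exists (Glued s s' lA MB rC lC MD rE), (ses_id _), (ses_id _).
  by split; apply: ses_heqW.
- move=> t u f.
  have [g gE] := extend_mid (gl_j u \o (hom_c f : {linear gl_c t -> gl_c u}))
    (gl_ses2 t) (gl_right2 t) (gl_mid2 u).
  have [|h hE] := descend_to_cokernel (gl_ses2 t) (f := gl_q u \o g).
    by move=> x /=; rewrite gE /= (short_exact0 (gl_ses2 u)).
  by exists (@SesHom _ _ _ _ (glued_snd t) (glued_snd u)
    (hom_c f : {linear gl_c t -> gl_c u}) g h (fun x => esym (gE x))
    (fun x => esym (hE x))).
- move=> t u g.
  have [f fE] := lift_mid ((hom_a g : {linear gl_c t -> gl_c u}) \o gl_p t)
    (gl_ses1 u) (gl_left1 u) (gl_mid1 t).
  have [|h hE] := lift_through_kernel (gl_ses1 u) (f := f \o gl_i t).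
    by move=> x /=; rewrite fE /= (short_exact0 (gl_ses1 t)) linear0.
  by exists (@SesHom _ _ _ _ (glued_fst t) (glued_fst u) h f
    (hom_a g : {linear gl_c t -> gl_c u}) hE fE).
- by move=> t x.
- by move=> t u v f g f' g' e e' x /=; rewrite e e'.
- by move=> t u f g f' g' e e' x /=; rewrite e e'.
- by move=> t u f g e x /=; rewrite e.
(* A homotopy [gl_c t -> gl_b u] extends to [gl_d t] because [gl_b u] is in [M], giving a left
   homotopy for [g]. Conversely, a homotopy [gl_d t -> gl_c u] lifts to [gl_b u] because [gl_d t] is
   in [M]. *)
- move=> t u f g e; split=> /ses_heq0 n; apply/ses_heq0.
    apply/ses_nullP; have [h hE] := n.
    have [k kE] := extend_mid (h : {linear gl_c t -> gl_b u})
      (gl_ses2 t) (gl_right2 t) (gl_mid1 u).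
    by exists (gl_p u \o k) => x; rewrite -e hE /= kE.
  have [h hE] := (ses_nullP g).1 n.
  have [k kE] := lift_mid (h : {linear gl_d t -> gl_c u})
    (gl_ses1 u) (gl_left1 u) (gl_mid2 t).
  by exists (k \o gl_j t) => x; rewrite e hE /= kE.
Qed.
End Step.

(** * Monomorphisms modulo the split ones *)

Section SplitArrows.
Variables (C : preadd) (P : arrow_cat C -> Prop).
Implicit Types x y k : full_sub P.

Definition split_arrow k :=
  exists s : hom (tgt (sval k)) (src (sval k)),
    s \oc arr (sval k) =h idm (src (sval k)).

(** Splitness survives finite sums, so it holds on all of [V_class]; it alone forces the source
    component of a factoring square to extend. *)
Lemma split_arrow_sum (K : full_sub P -> Prop) k :
  (forall k, K k -> split_arrow k) -> finite_sum K k -> split_arrow k.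
Proof.
move=> KS; elim=> {k} [z [z0 _]|k /KS //|x y z _ [s sx] _ [t ty]].
  by exists (hzero _ _); rewrite comp0f; apply: hsym.
move=> [i [j [p [q [_ _ _ _ [e _]]]]]].
exists ((sq_src i \oc s \oc sq_tgt p) +h (sq_src j \oc t \oc sq_tgt q)).
rewrite compDl -!compA -!sq_comm (compA s) sx (compA t) ty !comp1f.
exact: e.
Qed.

Lemma factors_split (K : full_sub P -> Prop) x y
    (f : square (sval x) (sval y)) :
  (forall k, K k -> split_arrow k) -> @factors (full_sub P) K x y f ->
  exists h : hom (tgt (sval x)) (src (sval y)), sq_src f =h h \oc arr (sval x).
Proof.
move=> KS [k [u [v [/(split_arrow_sum KS)[s sk] [e _]]]]].
exists (sq_src v \oc s \oc sq_tgt u).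
rewrite -!compA -(sq_comm u) (compA s) sk comp1f.
exact: e.
Qed.

(* The square [(h i, j h)], with [i] and [j] the arrows of [x] and [y], factors
   through the identity of the target of [x], and its difference with [f] is
   zero on sources. *)
Lemma split_square x y (f : square (sval x) (sval y))
    (h : hom (tgt (sval x)) (src (sval y))) (Z : C)
    (k1 : P (Arrow (idm (tgt (sval x)))))
    (k0 : P (Arrow (hzero Z (tgt (sval y))))) :
    sq_src f =h h \oc arr (sval x) ->
  let m1 : full_sub P := exist P _ k1 in let m0 : full_sub P := exist P _ k0 in
  exists (u1 : hom x m1) (v1 : hom m1 y) (u0 : hom x m0) (v0 : hom m0 y),
    (v1 \oc u1) +h (v0 \oc u0) =h f.
Proof.
move=> hE m1 m0; pose i := arr (sval x); pose j := arr (sval y).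
pose B := tgt (sval x); pose B' := tgt (sval y).
have c1 : idm B \oc i =h idm B \oc i by [].
have c2 : j \oc h =h (j \oc h) \oc idm B by rewrite compf1.
pose t := sq_tgt f +h hopp (j \oc h).
have c3 : hzero Z B' \oc hzero (src (sval x)) Z =h t \oc i.
  rewrite compf0 compDl compNf -sq_comm hE compA haddfN.
  by [].
have c4 : j \oc hzero Z _ =h idm B' \oc hzero Z B' by rewrite !compf0.
exists (@Square _ (sval x) (Arrow (idm B)) i (idm B) c1).
exists (@Square _ (Arrow (idm B)) (sval y) h (j \oc h) c2).
exists (@Square _ (sval x) (Arrow (hzero Z B')) (hzero _ _) t c3).
exists (@Square _ (Arrow (hzero Z B')) (sval y) (hzero _ _) (idm B') c4).
split; rewrite /=; first by rewrite hE compf0 haddf0.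
by rewrite compf1 comp1f /t haddC -haddA haddNf haddf0.
Qed.
End SplitArrows.

(** * The end of the chain at S(M)/V *)

Section MonoEnd.
Variables (R : pzRingType) (M : add_subcat R) (l r : fgmod R -> Prop).
Hypotheses (l_in : forall A : fgmod R, l A <-> M A) (r_all : forall A, r A).

Let obj (A : fgmod R) (MA : M A) : sub_cat M := exist _ A MA.

Lemma l_in_mem (x : ses M l r) : M (ses_a x).
Proof. exact: (l_in _).1 (ses_left x). Qed.

Lemma mono_of_ses_mono (x : ses M l r) :
  @is_mono R M (@Arrow (sub_cat M) (obj (l_in_mem x))
    (obj (ses_mid x)) (ses_i x)).
Proof. by case: (sesP x). Qed.

Definition mono_of_ses (x : ses M l r) : mono_cat M :=
  exist _ _ (@mono_of_ses_mono x).

Lemma V_class_split (k : mono_cat M) : V_class k -> split_arrow k.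
Proof.
apply: split_arrow_sum => {}k [[X e]|[Z [X [z0 e]]]]; rewrite /split_arrow e.
  by exists (idm X); apply: comp1f.
by exists (hzero _ _); apply: htrans (comp0f _ _) (hsym z0).
Qed.

Lemma factors_V_class (x y : mono_cat M) (f : square (sval x) (sval y)) :
  @factors (mono_cat M) (V_class (M := M)) x y f <->
  exists h : hom (tgt (sval x)) (src (sval y)),
    sq_src f =h h \oc arr (sval x).
Proof.
split=> [|[h hE]]; first exact: (factors_split V_class_split).
have [Z Z0] := has_zero (sub_cat M).
have k1 : is_mono (Arrow (idm (tgt (sval x)))) by [].
have k0 : is_mono (Arrow (hzero Z (tgt (sval y)))).
  by move=> a b _; rewrite (Z0 a : a = 0) (Z0 b : b = 0).
have [u1 [v1 [u0 [v0 e]]]] := split_square k1 k0 hE.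
apply: (@factors_eq (mono_cat M) _ _ _ _ _ e).
have V1 : V_class (exist _ _ k1 : mono_cat M).
  by apply: FiniteSum1; left; exists (tgt (sval x)).
have V0 : V_class (exist _ _ k0 : mono_cat M).
  by apply: FiniteSum1; right; exists Z, (tgt (sval y)).
apply: (@factorsD (mono_cat M)).
  exists (exist _ _ k1 : mono_cat M), u1, v1.
  exact: conj (FiniteSum1 V1) (hrefl _).
exists (exist _ _ k0 : mono_cat M), u0, v0.
exact: conj (FiniteSum1 V0) (hrefl _).
Qed.

(** A square determines the map of cokernels, and factoring through [V_class] is the existence of a
    left homotopy in the sense of [ses_nullP]. *)
Lemma mono_cat_ses_cat :
  ff_equivalent (quotient_cat (C := mono_cat M) (V_class (M := M)))
    (ses_cat M l r).
Proof.
pose Q := quotient_cat (C := mono_cat M) (V_class (M := M)).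
pose rel (t u : ses M l r) (f : hom (mono_of_ses t) (mono_of_ses u))
    (g : ses_hom t u) :=
  (sq_src f : {linear ses_a t -> ses_a u}) =1 hom_a g /\
  (sq_tgt f : {linear ses_b t -> ses_b u}) =1 hom_b g.
apply: (@span_ff_equivalent Q (ses_cat M l r) (ses M l r) mono_of_ses id rel).
- move=> [[[A MA] [B MB] f] inj].
  have [C [p s]] := cokernel_object inj.
  exists (Ses s ((l_in A).2 MA) MB (r_all C)).
  pose x := Ses s ((l_in A).2 MA) MB (r_all C).
  have -> : mono_of_ses x = exist _ _ inj.
    by apply: eq_exist; rewrite /= (Prop_irrelevance (l_in_mem x) MA).
  exact: iso_refl.
- by move=> t; exists t, (ses_id t), (ses_id t); split; apply: ses_heqW.
- move=> t u f.
  pose fa : {linear ses_a t -> ses_a u} := sq_src f.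
  pose fb : {linear ses_b t -> ses_b u} := sq_tgt f.
  have fab x : ses_i u (fa x) = fb (ses_i t x) := sq_comm f x.
  have [|fc fbc] := descend_to_cokernel (sesP t) (f := ses_p u \o fb).
    by move=> x /=; rewrite -fab (short_exact0 (sesP u)).
  by exists (SesHom fab (fun x => esym (fbc x))).
- move=> t u g.
  by exists (@Square _ (sval (mono_of_ses t)) (sval (mono_of_ses u))
    (hom_a g) (hom_b g) (hom_ab g)).
- by move=> t; split.
- by move=> t u v f g f' g' [e1 e2] [e1' e2']; split=> x /=;
    rewrite (e1, e2) (e1', e2').
- by move=> t u f g f' g' [e1 e2] [e1' e2']; split=> x /=;
    rewrite (e1, e2) (e1', e2').
- by move=> t u f g [e1 e2]; split=> x /=; rewrite (e1, e2).
- move=> t u f g [e1 e2].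
  have -> : f =h hzero (mono_of_ses t : Q) (mono_of_ses u) <->
      factors (V_class (M := M)) (f : @hom (mono_cat M) _ _).
    by split; apply: factors_eq; split=> x /=; rewrite oppr0 addr0.
  rewrite factors_V_class; split=> [[h hE]|/ses_heq0/ses_nullP[h hE]].
    by apply/ses_heq0/ses_nullP; exists h => x; rewrite -e1; apply: hE.
  by exists h => x; rewrite /= e1 hE.
Qed.
End MonoEnd.

(** * Finitely presented functors *)

Section AdditiveOf.
Variables (A B : zmodType) (f : A -> B).
Hypothesis fB : zmod_morphism f.
Definition additive_of_fun of zmod_morphism f := f.
HB.instance Definition _ :=
  GRing.isZmodMorphism.Build A B (additive_of_fun fB) fB.

Lemma additive_of : exists g : {additive A -> B}, g =1 f.
Proof. by exists (additive_of_fun fB). Qed.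
End AdditiveOf.

Lemma additive_descend (A B C : zmodType) (p : {additive A -> B})
    (f : {additive A -> C}) :
    surjective p -> (forall x, p x = 0 -> f x = 0) ->
  exists h : {additive B -> C}, forall x, h (p x) = f x.
Proof.
move=> /choice[s sE] kf.
have fE x y : p x = p y -> f x = f y.
  by move=> e; apply/eqP; rewrite -subr_eq0 -raddfB kf // raddfB e subrr.
pose h := f \o s.
have hE x : h (p x) = f x by apply: fE; rewrite sE.
have [|g gE] := @additive_of B C h; last by exists g => x; rewrite gE.
by move=> x y; rewrite -[x]sE -[y]sE -raddfB !hE raddfB.
Qed.

Section Presheaves.
Variable C : preadd.
Implicit Types F G : functor (op C) abcat.

(** [sec], [res] and [nt_sec] are typed views that undo [op] and [abcat], exposing groups and
    additive maps. *)
Definition sec F (X : C) : zmodType := fobj F X.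

Definition res F (X Y : C) (g : hom X Y) : {additive sec F Y -> sec F X} :=
  @fmap (op C) abcat F Y X g.

Definition nt_sec F G (a : nat_trans F G) (X : C) :
  {additive sec F X -> sec G X} := @nt (op C) abcat F G a X.

Lemma nt_sec_res F G (a : nat_trans F G) X Y (g : hom X Y) u :
  nt_sec a X (res F g u) = res G g (nt_sec a Y u).
Proof. exact/esym/(@nt_nat (op C) abcat F G a Y X g u). Qed.

Lemma nat_trans_of F G (a : forall X : C, {additive sec F X -> sec G X}) :
  (forall X Y (g : hom X Y) u, a X (res F g u) = res G g (a Y u)) ->
  exists b : nat_trans F G, forall X, nt_sec b X = a X.
Proof.
move=> aE; unshelve eexists (@NatTrans (op C) abcat F G a _) => //.
by move=> Y X g u; apply/esym/aE.
Qed.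

Lemma nt_sec_comp F G H (b : nat_trans G H) (a : nat_trans F G) X u :
  nt_sec (nt_comp b a) X u = nt_sec b X (nt_sec a X u).
Proof. by []. Qed.

Lemma nt_sec_add F G (a b : nat_trans F G) X u :
  nt_sec (nt_add a b) X u = nt_sec a X u + nt_sec b X u.
Proof. by []. Qed.

Lemma nt_sec_opp F G (a : nat_trans F G) X u :
  nt_sec (nt_opp a) X u = - nt_sec a X u.
Proof. by []. Qed.

Lemma funcat_heq0 F G (a : nat_trans F G) :
  @heq (funcat (op C) abcat) F G a (nt_zero F G) <->
  forall X x, nt_sec a X x = 0.
Proof. exact: iff_refl. Qed.

Lemma res_heq F X Y (f g : hom X Y) : f =h g -> res F f =1 res F g.
Proof. exact: (@fmap_proper (op C) abcat F). Qed.

Lemma presheaf_descend F G H (p : nat_trans F G) (f : nat_trans F H) :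
    (forall X, surjective (nt_sec p X)) ->
    (forall X u, nt_sec p X u = 0 -> nt_sec f X u = 0) ->
  exists h : nat_trans G H,
    forall X u, nt_sec h X (nt_sec p X u) = nt_sec f X u.
Proof.
move=> ps pf.
have ex X : exists h : {additive sec G X -> sec H X},
    forall u, h (nt_sec p X u) = nt_sec f X u.
  by apply: additive_descend => // u; apply: pf.
have [|h hE] := nat_trans_of (a := fun X => projT1 (cid (ex X))).
  move=> X Y g u; have [v <-] := ps Y u.
  by rewrite -nt_sec_res !(projT2 (cid (ex _))) nt_sec_res.
by exists h => X u; rewrite hE (projT2 (cid (ex X))).
Qed.

Lemma presheaf_quotient F (N : forall X, sec F X -> Prop) :
    (forall X, subgroup (N X)) ->
    (forall X Y (g : hom X Y) u, N Y u -> N X (res F g u)) ->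
  exists G (p : nat_trans F G),
    forall X, surjective (nt_sec p X) /\ forall u, nt_sec p X u = 0 <-> N X u.
Proof.
move=> Nsub Nres.
have ex X := zmod_quotient (Nsub X).
pose S X := projT1 (cid (ex X)).
have exp X : exists p : {additive sec F X -> S X},
    surjective p /\ forall u, p u = 0 <-> N X u.
  exact: projT2 (cid (ex X)).
pose p X := projT1 (cid (exp X)).
have ps X : surjective (p X) by case: (projT2 (cid (exp X))).
have pN X u : p X u = 0 <-> N X u by case: (projT2 (cid (exp X))).
have exr X Y (g : hom X Y) : exists h : {additive S Y -> S X},
    forall u, h (p Y u) = p X (res F g u).
  have [|h hE] := additive_descend (f := p X \o res F g) (ps Y).
    by move=> u /pN/(Nres _ _ g)/pN.
  by exists h.
pose re X Y (g : hom X Y) := projT1 (cid (exr X Y g)).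
have reE X Y g u : re X Y g (p Y u) = p X (res F g u).
  exact: projT2 (cid (exr X Y g)) u.
have reP (X Y : op C) (g g' : hom X Y) : g =h g' -> re Y X g =1 re Y X g'.
  by move=> e u; have [v <-] := ps X u; rewrite !reE (@res_heq F Y X g g' e).
have re1 (X : op C) : re X X (idm X) =1 id.
  move=> u; have [v <-] := ps X u; rewrite reE; congr (p X _).
  exact: (@fmap1 (op C) abcat F).
have reC (X Y Z : op C) (g : hom Y Z) (f : hom X Y) :
    re Z X (g \oc f) =1 re Z Y g \o re Y X f.
  move=> u; have [v <-] := ps X u; rewrite /= !reE; congr (p Z _).
  exact: (@fmap_comp (op C) abcat F).
have reD (X Y : op C) (f g : hom X Y) u :
    re Y X (f +h g) u = re Y X f u + re Y X g u.
  have [v <-] := ps X u; rewrite !reE -raddfD; congr (p Y _).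
  exact: (@fmapD (op C) abcat F).
pose G : functor (op C) abcat :=
  @Functor (op C) abcat S (fun X Y g => re Y X g) reP re1 reC reD.
have [|q qE] := @nat_trans_of F G p.
  by move=> X Y g u; rewrite -reE.
by exists G, q => X; rewrite qE; split.
Qed.
End Presheaves.

Section Representable.
Variables (R : pzRingType) (M : add_subcat R).
Implicit Types (X Y B C : sub_cat M) (F G : functor (op (sub_cat M)) abcat).

(** Sections are compared by Leibniz equality and morphisms by [heq]; this cast marks the passage
    between them. *)
Definition el X C (u : hom X C) : sec (hom_functor C) X := u.

Lemma el_surj X C (v : sec (hom_functor C) X) : exists u, el u = v.
Proof. by exists (v : {linear sub_mod X -> sub_mod C}). Qed.

Lemma el_heq X C (u v : hom X C) : u =h v -> el u = el v.
Proof. exact: sub_ext. Qed.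

Lemma elE X C (u v : hom X C) :
  el u = el v -> forall x, sub_lin u x = sub_lin v x.
Proof. by rewrite /el => ->. Qed.

Lemma elD X C (u v : hom X C) : el (u +h v) = el u + el v.
Proof. by []. Qed.

Lemma elN X C (u : hom X C) : el (hopp u) = - el u.
Proof. by []. Qed.

Lemma el0 X C : el (hzero X C) = 0.
Proof. by []. Qed.

Lemma res_el X Y C (g : hom X Y) (u : hom Y C) :
  res (hom_functor C) g (el u) = el (u \oc g).
Proof. by []. Qed.

Lemma nt_sec_map X B C (p : hom B C) (u : hom X B) :
  nt_sec (hom_functor_map p) X (el u) = el (p \oc u).
Proof. by []. Qed.

Definition presents B C (p : hom B C) F (pi : nat_trans (hom_functor C) F) :=
  forall X, surjective (nt_sec pi X) /\
    forall u : hom X C,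
      nt_sec pi X (el u) = 0 <-> exists v, el (p \oc v) = el u.

Definition exact_at B C F (a : nat_trans (hom_functor B) (hom_functor C))
    (b : nat_trans (hom_functor C) F) (X : sub_cat M) :=
  surjective (nt_sec b X) /\
    forall u, nt_sec b X u = 0 <-> exists v, nt_sec a X v = u.

Lemma presents_exact B C (p : hom B C) F (pi : nat_trans (hom_functor C) F) :
  presents p pi -> forall X, exact_at (hom_functor_map p) pi X.
Proof.
by move=> pF X; have [ps pE] := pF X; split.
Qed.

(** Yoneda: [a] is composition with its value [p] at the identity of [B]. *)
Lemma exact_presents B C F (a : nat_trans (hom_functor B) (hom_functor C))
    (b : nat_trans (hom_functor C) F) : (forall X, exact_at a b X) ->
  exists p : hom B C, presents p b.
Proof.
move=> ab; have [p pE] := el_surj (nt_sec a B (el (idm B))).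
have aE X (v : hom X B) : nt_sec a X (el v) = el (p \oc v).
  have -> : el v = res (hom_functor B) v (el (idm B)).
    by rewrite res_el; apply: el_heq; apply: hsym; apply: comp1f.
  by rewrite nt_sec_res -pE res_el.
exists p => X; have [bs bE] := ab X; split=> // u.
rewrite bE; split=> -[v <-]; last by exists (el v); rewrite aE.
by have [w <-] := el_surj v; exists w; rewrite aE.
Qed.

Lemma finitely_presentedP F : @finitely_presented R M F <->
  exists B C (p : hom B C) (pi : nat_trans (hom_functor C) F), presents p pi.
Proof.
split; intros h.
  destruct h as (B & C & a & b & ab).
  destruct (@exact_presents B C F a b ab) as (p & pF).
  exact (ex_intro _ B (ex_intro _ C (ex_intro _ p (ex_intro _ b pF)))).
destruct h as (B & C & p & pi & pF).
exists B, C, (hom_functor_map p), pi.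
exact (presents_exact pF).
Qed.

End Representable.

(** * The end of the chain at functors vanishing on projectives *)

Section FunctorEnd.
Variables (R : pzRingType) (M : add_subcat R) (l r : fgmod R -> Prop).
Hypotheses (l_all : forall A, l A) (r_in : forall A : fgmod R, r A <-> M A)
  (proj_in : forall P : fgmod R, projective P -> M P)
  (noeth : forall A : fgmod R, noetherian A).

Lemma vanishes_on_projectivesP (F : functor (op (sub_cat M)) abcat) :
  @vanishes_on_projectives R M F <->
  forall P : sub_cat M, projective (sub_mod P) -> forall u : sec F P, u = 0.
Proof. exact: iff_refl. Qed.

Record presented := Presented {
  pd_a : fgmod R; pd_b : sub_cat M; pd_c : sub_cat M;
  pd_i : {linear pd_a -> sub_mod pd_b}; pd_p : hom pd_b pd_c;
  pd_ses : short_exact pd_i (sub_lin pd_p);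
  pd_fun : functor (op (sub_cat M)) abcat;
  pd_fp : @fp_stable R M pd_fun;
  pd_pi : nat_trans (hom_functor pd_c) pd_fun;
  pd_presents : presents pd_p pd_pi }.

Definition presented_ses (t : presented) : ses M l r :=
  Ses (pd_ses t) (l_all (pd_a t)) (svalP (pd_b t))
    ((r_in _).2 (svalP (pd_c t))).

Definition presented_fun (t : presented) : full_sub (@fp_stable R M) :=
  exist _ (pd_fun t) (pd_fp t).

Definition presented_rel t u (f : ses_hom (presented_ses t) (presented_ses u))
    (g : nat_trans (pd_fun t) (pd_fun u)) :=
  forall X (v : hom X (pd_c t)),
    nt_sec g X (nt_sec (pd_pi t) X (el v)) =
    nt_sec (pd_pi u) X (el ((hom_c f : hom (pd_c t) (pd_c u)) \oc v)).

Section Rel.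
Variables t u : presented.
Implicit Types (f : ses_hom (presented_ses t) (presented_ses u))
  (g : nat_trans (pd_fun t) (pd_fun u)).

Lemma pd_pi_eq0 X (v : hom X (pd_c t)) :
  nt_sec (pd_pi t) X (el v) = 0 <-> exists w, el (pd_p t \oc w) = el v.
Proof. by have [_] := pd_presents t X; apply. Qed.

Lemma pd_pi_surj X : surjective (nt_sec (pd_pi t) X).
Proof. by have [] := pd_presents t X. Qed.

Lemma presented_rel_left f : exists g, presented_rel f g.
Proof.
pose fc : hom (pd_c t) (pd_c u) := hom_c f.
pose fb : hom (pd_b t) (pd_b u) := hom_b f.
have fbc : pd_p u \oc fb =h fc \oc pd_p t := hom_bc f.
have [|X v v0|g gE] := @presheaf_descend _ _ _ _ (pd_pi t)
  (nt_comp (pd_pi u) (hom_functor_map fc)); first exact: pd_pi_surj.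
  rewrite nt_sec_comp; have [w wv] := el_surj v; move: v0; rewrite -wv.
  move=> /pd_pi_eq0[y <-]; rewrite nt_sec_map.
  have [_ pE] := pd_presents u X; apply/pE; exists (fb \oc y).
  by apply: el_heq; rewrite !compA fbc.
by exists g => X v; rewrite gE.
Qed.

(** By Yoneda, [g] lifts to a map [w] of representing objects. Its composite with [pd_p t] dies in
    the target functor, hence factors through [pd_p u], which gives the middle component. *)
Lemma presented_rel_right g : exists f, presented_rel f g.
Proof.
have [_ pE] := pd_presents u (pd_b t).
have [y yE] := (pd_presents u (pd_c t)).1
  (nt_sec g _ (nt_sec (pd_pi t) _ (el (idm (pd_c t))))).
have [w wy] := el_surj y; rewrite -{y}wy in yE.
have wE X (v : hom X (pd_c t)) :
    nt_sec g X (nt_sec (pd_pi t) X (el v)) = nt_sec (pd_pi u) X (el (w \oc v)).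
  have -> : el v = res (hom_functor (pd_c t)) v (el (idm _)).
    by rewrite res_el; apply: el_heq; apply: hsym; apply: comp1f.
  by rewrite !nt_sec_res -yE -nt_sec_res res_el.
have /pE[fb fbE] : nt_sec (pd_pi u) _ (el (w \oc pd_p t)) = 0.
  rewrite -wE (_ : nt_sec (pd_pi t) _ _ = 0) ?raddf0 //.
  by apply/pd_pi_eq0; exists (idm _); apply: el_heq; apply: compf1.
have {}fbE x : sub_lin (pd_p u) (sub_lin fb x) = sub_lin w (sub_lin (pd_p t) x).
  exact: elE fbE x.
have [|fa faE] := lift_through_kernel (pd_ses u) (f := sub_lin fb \o pd_i t).
  by move=> x; rewrite /= fbE (short_exact0 (pd_ses t)) linear0.
by exists (@SesHom _ _ _ _ (presented_ses t) (presented_ses u) fa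
  (sub_lin fb) (sub_lin w) faE fbE).
Qed.

(** [g] vanishes as soon as it kills the class of the identity of [pd_c t], and this says that
    [hom_c f] factors through [pd_p u]. *)
Lemma presented_rel0 f g : presented_rel f g ->
  (ses_null (hom_c f) <-> forall X x, nt_sec g X x = 0).
Proof.
move=> fg; split=> [[h hE] X x|g0].
  have [y <-] := @pd_pi_surj X x; have [v <-] := el_surj y.
  rewrite fg; have [_ pE] := pd_presents u X; apply/pE.
  exists ((h : hom (pd_c t) (pd_b u)) \oc v).
  by apply: el_heq => z; apply/esym/hE.
have := fg _ (idm (pd_c t)); rewrite g0 => /esym.
have [_ pE] := pd_presents u (pd_c t); move=> /pE[h /elE hE].
by exists (sub_lin h) => x; rewrite -[LHS](hE x).
Qed.
End Rel.

Lemma ses_presented (x : ses M l r) :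
  exists t, @iso (ses_cat M l r) (presented_ses t) x.
Proof.
case: x => A B C i p s lA MB rC.
pose B' : sub_cat M := exist _ B MB.
pose C' : sub_cat M := exist _ C ((r_in C).1 rC).
pose p' : hom B' C' := p.
have [||F [pi piE]] := @presheaf_quotient _ (hom_functor C')
    (fun X x => exists v, el (p' \oc v) = x).
- move=> X; split=> [|x y [v <-] [w <-]].
    by exists (hzero _ _); rewrite -el0; apply: el_heq; apply: compf0.
  exists (v +h hopp w); rewrite -elN -elD; apply: el_heq.
  by rewrite compDr compfN.
- move=> X Y g x [v <-]; exists (v \oc g).
  by rewrite res_el; apply: el_heq; rewrite compA.
have pF : presents p' pi.
  by move=> X; have [ps pE] := piE X; split=> // v; apply: pE.
have fpF : @fp_stable R M F.
  split; first by apply/finitely_presentedP; exists B', C', p', pi.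
  apply/vanishes_on_projectivesP => P pP x.
  have [ps pE] := pF P; have [y <-] := ps x; have [v <-] := el_surj y.
  have [_ sp _] := s; have [w wE] := pP _ _ p (sub_lin v) sp.
  by apply/pE; exists (w : hom P B'); apply: el_heq.
exists (@Presented A B' C' i p' s F fpF pi pF).
pose t := @Presented A B' C' i p' s F fpF pi pF.
pose x := Ses s lA MB rC.
exists (@SesHom _ _ _ _ (presented_ses t) x idfun idfun idfun
  (fun=> erefl) (fun=> erefl)).
exists (@SesHom _ _ _ _ x (presented_ses t) idfun idfun idfun
  (fun=> erefl) (fun=> erefl)).
by split; apply: ses_heqW.
Qed.

(** Vanishing on projectives makes [p] surjective: an epimorphism [q] from a projective to [C] has
    zero class in [F], so it factors through [p]. *)
Lemma fun_presented (F : full_sub (@fp_stable R M)) :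
  exists t, iso (presented_fun t) F.
Proof.
case: F => F fpF; have [fp van] := fpF.
have [B [C [p [pi pF]]]] := (finitely_presentedP F).1 fp.
have sp : surjective (sub_lin p).
  have [P [q [pP qs]]] := projective_cover (sub_mod C).
  pose P' : sub_cat M := exist _ P (proj_in pP).
  have [_ pE] := pF P'.
  have /pE[w /elE wE] : nt_sec pi P' (el (q : hom P' C)) = 0.
    by apply: (vanishes_on_projectivesP F).1.
  move=> y; have [x <-] := qs y; exists (sub_lin w x).
  exact: wE.
have [A [i [ii iE]]] := kernel_object noeth (sub_lin p).
have s : short_exact i (sub_lin p) by split.
by exists (Presented s fpF pF); apply: iso_refl.
Qed.

Lemma mod_stable_heq0 (F G : mod_stable M) (g : nat_trans (sval F) (sval G)) :
  @heq (mod_stable M) F G g (hzero F G) <-> forall X x, nt_sec g X x = 0.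
Proof. exact (funcat_heq0 g). Qed.

Lemma ses_cat_mod_stable : ff_equivalent (ses_cat M l r) (mod_stable M).
Proof.
apply: (@span_ff_equivalent (ses_cat M l r) (mod_stable M) presented
  presented_ses presented_fun (@presented_rel)).
- exact: ses_presented.
- exact: fun_presented.
- exact: presented_rel_left.
- exact: presented_rel_right.
- move=> t X v; have -> : el (idm (pd_c t) \oc v) = el v by exact: el_heq.
  by [].
- move=> t u v f g f' g' fg fg' X w.
  rewrite nt_sec_comp fg fg'; congr (nt_sec _ X _).
  by apply: el_heq.
- move=> t u f g f' g' fg fg' X w.
  rewrite nt_sec_add fg fg' -raddfD -elD; congr (nt_sec _ X _).
  by apply: el_heq.
- move=> t u f g fg X w.
  rewrite nt_sec_opp fg -raddfN -elN; congr (nt_sec _ X _).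
  by apply: el_heq.
- move=> t u f g /presented_rel0 fg.
  exact (iff_trans (ses_heq0 f) (iff_trans fg (iff_sym
    (@mod_stable_heq0 (presented_fun t) (presented_fun u) g)))).
Qed.
End FunctorEnd.

(** * Cluster tilting subcategories *)

Section ClusterTilting.
Variables (R : pzRingType) (M : add_subcat R) (m : nat).
Hypotheses (noeth : forall A : fgmod R, noetherian A)
  (hM : cluster_tilting m.+1 M).

(** With the shift in [ext_vanishes], this is Ext^i(M, A) = 0 for 0 < i <= k; so [k = m] is the
    cluster tilting condition for [n = m.+1]. *)
Definition left_orth k (A : fgmod R) :=
  forall X i, M X -> (i < k)%N -> ext_vanishes i X A.

Definition right_orth k (A : fgmod R) :=
  forall X i, M X -> (i < k)%N -> ext_vanishes i A X.

Lemma left_orth_mem (A : fgmod R) : left_orth m A <-> M A.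
Proof.
have [_ _ + _] := hM => /(_ A)->; split=> h X.
  by move=> [|i] //= MX im; apply/(Ext_eq0_vanishes noeth)/h.
by move=> i MX im; apply/(Ext_eq0_vanishes noeth)/h.
Qed.

Lemma right_orth_mem (A : fgmod R) : right_orth m A <-> M A.
Proof.
have [_ _ _ +] := hM => /(_ A)->; split=> h X.
  by move=> [|i] //= MX im; apply/(Ext_eq0_vanishes noeth)/h.
by move=> i MX im; apply/(Ext_eq0_vanishes noeth)/h.
Qed.

Lemma cluster_tilting_self_orth (X Y : fgmod R) i :
  M X -> M Y -> (i < m)%N -> ext_vanishes i X Y.
Proof. by move=> MX /left_orth_mem; apply. Qed.

Lemma projective_mem (P : fgmod R) : projective P -> M P.
Proof.
move=> pP; apply/right_orth_mem => X i _ _.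
exact: ext_vanishes_projective.
Qed.

(** An embedding of [A] into an object of [M] factors through any left approximation, which is
    therefore injective. *)
Lemma mono_left_approx (A : fgmod R) :
  exists (B : fgmod R) (f : {linear A -> B}), injective f /\ left_approx M f.
Proof.
have [ff gc _ _] := hM; have [_ [B [f fB]]] := ff A.
have [_ [X [g [MX gi]]]] := gc A; exists B, f; split=> // x y e; apply: gi.
by have [h hE] := fB.2 X MX g; rewrite !hE /= e.
Qed.

Lemma epi_right_approx (A : fgmod R) :
  exists (B : fgmod R) (f : {linear B -> A}), surjective f /\ right_approx M f.
Proof.
have [ff gc _ _] := hM; have [[B [f fB]] _] := ff A.
have [[X [g [MX gs]]] _] := gc A; exists B, f; split=> // y.
have [h hE] := fB.2 X MX g; have [x <-] := gs y.
by exists (h x); rewrite hE.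
Qed.

(** The bounds keep every use of Ext-vanishing between objects of [M] in degrees below n. *)
Lemma orth_step l r : (l < m)%N -> (r < m)%N ->
  ff_equivalent (ses_cat M (left_orth l.+1) (right_orth r))
    (ses_cat M (left_orth l) (right_orth r.+1)).
Proof.
move=> lm rm; apply: ses_cat_step.
- move=> A B C X i p f ses lA MX.
  exact: (lift_of_ext1_vanishes noeth f ses (lA X 0%N MX isT)).
- move=> A B C X i p f ses rC MX.
  exact: (rC X 0%N MX isT A B i p ses f).
- case=> A B C i p ses lA MB rC /=.
  have [D [j [ji [MD jD]]]] := mono_left_approx C.
  have [E [q ses']] := cokernel_object ji.
  exists D, E, j, q; split=> // X [|k] MX km.
  (* Ext^i(X, C) lies between Ext^i(X, B), zero since [B] is in [M], and Ext^(i+1)(X, A): one degree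
     is lost on the left. *)
  + apply: (ext_vanishes_quotient noeth ses); last exact: lA.
    by apply: cluster_tilting_self_orth => //; apply: leq_ltn_trans lm.
  + apply: (ext_vanishes_quotient noeth ses); last exact: lA.
    by apply: cluster_tilting_self_orth => //; apply: ltn_trans lm.
  (* The degree gained on the right: Ext^1(E, X) vanishes because maps from [C] to [X] extend along
     the approximation. Higher degrees come from those of [C] by dimension shift. *)
  + apply: (ext1_vanishes_cokernel noeth ses').
      by apply: cluster_tilting_self_orth => //; apply: leq_ltn_trans rm.
    by move=> u; have [v vE] := jD X MX u; exists v => x; rewrite vE.
  + apply: (ext_vanishes_cokernel noeth ses'); first exact: rC.
    by apply: cluster_tilting_self_orth => //; apply: leq_ltn_trans rm.
- case=> C D E j q ses' lC MD rE /=.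
  have [B [p [ps [MB pB]]]] := epi_right_approx C.
  have [A [i [ii iE]]] := kernel_object noeth p.
  have ses : short_exact i p by split.
  exists A, B, i, p; split=> // X k MX km; last first.
    apply: (ext_vanishes_kernel noeth ses'); last exact: rE.
    by apply: cluster_tilting_self_orth => //; apply: ltn_trans rm.
  case: k km => [|k] km.
    apply: (ext1_vanishes_lift ses).
      by apply: cluster_tilting_self_orth => //; apply: leq_ltn_trans lm.
    by move=> f; have [g gE] := pB X MX f; exists g => x; rewrite gE.
  apply: (ext_vanishes_sub ses); first exact: lC.
  by apply: cluster_tilting_self_orth => //; apply: leq_ltn_trans lm.
Qed.

Lemma orth_chain j : (j <= m)%N ->
  ff_equivalent (ses_cat M (left_orth m) (right_orth 0))
    (ses_cat M (left_orth (m - j)) (right_orth j)).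
Proof.
elim: j => [_|j IH jm]; first by rewrite subn0; apply: ff_equivalent_refl.
apply: ff_equivalent_trans (IH (ltnW jm)) _.
(* This turns [m - j] into [(m - j.+1).+1], the form in which [orth_step] lowers the left index. *)
rewrite -(subnSK jm); apply: orth_step => //.
by rewrite subnSK // leq_subr.
Qed.

Lemma mono_cat_mod_stable :
  equivalent (quotient_cat (C := mono_cat M) (V_class (M := M))) (mod_stable M).
Proof.
apply: ff_equivalent_equivalent.
have mono_end : ff_equivalent
    (quotient_cat (C := mono_cat M) (V_class (M := M)))
    (ses_cat M (left_orth m) (right_orth 0)).
  by apply: mono_cat_ses_cat left_orth_mem _.
apply: ff_equivalent_trans mono_end _.
apply: ff_equivalent_trans (orth_chain (leqnn m)) _; rewrite subnn.
apply: ses_cat_mod_stable => //; first exact: right_orth_mem.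
exact: projective_mem.
Qed.
End ClusterTilting.

Theorem corollary4p2 (L : pzRingType) (hL : artin_algebra L)
    (n : nat) (n_gt0 : (0 < n)%N)
    (M : add_subcat L^c) (hM : cluster_tilting n M) :
  equivalent (quotient_cat (C := mono_cat M) (V_class (M := M))) (mod_stable M).
Proof.
case: n n_gt0 hM => // m _ hM; apply: mono_cat_mod_stable hM => A.
exact: artin_algebra_noetherian.
Qed.
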